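(* The ordered monomials $X_{11}^{a_{11}}X_{12}^{a_{12}}\cdots X_{1,2n}^{a_{1,2n}}X_{21}^{a_{21}}\cdots X_{2,2n}^{a_{2,2n}}$ ($a_{ij}\in\mathbb Z_{\ge0}$) form a $k$-basis of $\mathbb X_{n,q}$, and $\mathbb X_{n,q}$ is an iterated Ore extension $$\mathbb X_{n,q}=k[X_{11}][X_{12};\tau_{12},\delta_{12}]\cdots[X_{1,2n};\tau_{1,2n},\delta_{1,2n}][X_{21};\tau_{21},\delta_{21}]\cdots[X_{2,2n};\tau_{2,2n},\delta_{2,2n}]$$ for suitable automorphisms $\tau_{ij}$ and $\tau_{ij}$-derivations $\delta_{ij}$.
   Context: $k$ algebraically closed of characteristic $0$, $q\in k^\times$ transcendental over $\mathbb Q$, $\hat q=q-q^{-1}$, $n\ge3$, and $s'=2n+1-s$. $\mathbb X_{n,q}$ is the $k$-algebra generated by $X_{ij}$ ($i\in\{1,2\}$, $1\le j\le 2n$) with defining relations (indices in $\{1,\dots,2n\}$): $X_{rt}X_{rs}=q^{-1}X_{rs}X_{rt}$ ($r\in\{1,2\}$, $s<t$, $t\ne s'$); $X_{rs'}X_{rs}=X_{rs}X_{rs'}+\hat q\sum_{l=s+1}^nq^{l-s-1}X_{rl}X_{rl'}$ ($r\in\{1,2\}$, $s<s'$); $X_{2s}X_{1s}=q^{-1}X_{1s}X_{2s}$; $X_{2s}X_{1t}=X_{1t}X_{2s}$ ($s<t$, $t\ne s'$); $X_{2t}X_{1s}=X_{1s}X_{2t}-\hat qX_{1t}X_{2s}$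 ($s<t$, $t\ne s'$); $X_{2s}X_{1s'}=qX_{1s'}X_{2s}+\hat q\sum_{l=1}^{s-1}q^{s-l}X_{1l'}X_{2l}$ ($s<s'$); $X_{2s'}X_{1s}=qX_{1s}X_{2s'}+\hat q\sum_{l=s+1}^nq^{l-s}X_{1l}X_{2l'}+\hat qq^{-1}\sum_{l=1}^nq^{l'-s}X_{1l'}X_{2l}-\hat qX_{1s'}X_{2s}$ ($s<s'$). *)

(* Defs.v *)
From HB Require Import structures.
From mathcomp Require Import all_boot all_order all_algebra.
Set Implicit Arguments. Unset Strict Implicit. Unset Printing Implicit Defensive.
Import Order.TTheory GRing.Theory Num.Theory.
Local Open Scope ring_scope.

Section XDefs.
Variable k : fieldType.

Definition transcendental_over_Q (q : k) : Prop :=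
  forall p : {poly rat}, p != 0 -> (map_poly (@ratr k) p).[q] != 0.

(* The defining relations of X_{n,q}, for a family X r j (r in {1,2},
   1 <= j <= 2n, 1-based natural indices as in the paper) in a k-algebra B.
   s' = 2n+1-s; "s < s'" is equivalent to s <= n. *)
Definition Xrels (n : nat) (q : k) (B : algType k) (X : nat -> nat -> B) : Prop :=
  let qh := q - q^-1 in
  let pr := fun s : nat => ((2 * n).+1 - s)%N in
  (
      (forall r s t, (1 <= r <= 2)%N -> (1 <= s)%N -> (s < t)%N -> (t <= 2 * n)%N ->
         t <> pr s -> X r t * X r s = q^-1 *: (X r s * X r t)) /\
      (forall r s, (1 <= r <= 2)%N -> (1 <= s)%N -> (s <= n)%N ->
         X r (pr s) * X r s = X r s * X r (pr s)
           + qh *: \sum_(s.+1 <= l < n.+1) q ^+ (l - s - 1) *: (X r l * X r (pr l))) /\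
      (forall s, (1 <= s <= 2 * n)%N -> X 2 s * X 1 s = q^-1 *: (X 1 s * X 2 s)) /\
      (forall s t, (1 <= s)%N -> (s < t)%N -> (t <= 2 * n)%N -> t <> pr s ->
         X 2 s * X 1 t = X 1 t * X 2 s) /\
      (forall s t, (1 <= s)%N -> (s < t)%N -> (t <= 2 * n)%N -> t <> pr s ->
         X 2 t * X 1 s = X 1 s * X 2 t - qh *: (X 1 t * X 2 s)) /\
      (forall s, (1 <= s)%N -> (s <= n)%N ->
         X 2 s * X 1 (pr s) = q *: (X 1 (pr s) * X 2 s)
           + qh *: \sum_(1 <= l < s) q ^+ (s - l) *: (X 1 (pr l) * X 2 l)) /\
      (forall s, (1 <= s)%N -> (s <= n)%N ->
         X 2 (pr s) * X 1 s = q *: (X 1 s * X 2 (pr s))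
           + qh *: \sum_(s.+1 <= l < n.+1) q ^+ (l - s) *: (X 1 l * X 2 (pr l))
           + (qh * q^-1) *: \sum_(1 <= l < n.+1) q ^+ (pr l - s) *: (X 1 (pr l) * X 2 l)
           - qh *: (X 1 (pr s) * X 2 s))).

Definition is_alg_morph (A B : algType k) (f : A -> B) : Prop :=
  [/\ f 1 = 1, (forall a b, f (a + b) = f a + f b),
      (forall a b, f (a * b) = f a * f b) & (forall (c : k) a, f (c *: a) = c *: f a)].

Variable A : algType k.

(* The generators in the order X_11,...,X_{1,2n},X_21,...,X_{2,2n}:
   gen t = X (t / 2n + 1) (t mod 2n + 1), for t < 4n. *)
Definition gen (n : nat) (X : nat -> nat -> A) (t : nat) : A :=
  X (t %/ (2 * n))%N.+1 (t %% (2 * n))%N.+1.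

Definition wordprod (g : nat -> A) (w : seq nat) : A := \prod_(t <- w) g t.

Definition in_subalg (g : nat -> A) (m : nat) (z : A) : Prop :=
  exists ws : seq (k * seq nat),
    all (fun p => all (fun t => (t < m)%N) p.2) ws /\
    z = \sum_(p <- ws) p.1 *: wordprod g p.2.

(* S = R[x; tau, delta] (internal form): tau is a k-algebra automorphism of R,
   delta is a k-linear (left) tau-derivation of R (delta(ab)=tau(a)delta(b)+delta(a)b),
   x r = tau(r) x + delta(r) for r in R, and S is a free left R-module with
   basis 1, x, x^2, ... . *)
Definition is_ore_ext (R S : A -> Prop) (x : A) : Prop :=
  exists tau delta : A -> A,
  [/\ ((forall r, R r -> R (tau r)) /\
          (forall r, R r -> exists r', R r' /\ tau r' = r) /\
          (forall r r', R r -> R r' -> tau r = tau r' -> r = r') /\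
          (forall r r', R r -> R r' -> tau (r + r') = tau r + tau r') /\
          (forall r r', R r -> R r' -> tau (r * r') = tau r * tau r') /\
          tau 1 = 1 /\
          (forall (c : k) r, R r -> tau (c *: r) = c *: tau r)),
      [/\ (forall r, R r -> R (delta r)),
          (forall r r', R r -> R r' -> delta (r + r') = delta r + delta r'),
          (forall (c : k) r, R r -> delta (c *: r) = c *: delta r) &
          (forall r r', R r -> R r' ->
             delta (r * r') = tau r * delta r' + delta r * r')],
      (forall r, R r -> x * r = tau r * x + delta r),
      (forall s, S s <-> exists rs : seq A, (forall i, R rs`_i) /\
                   s = \sum_(i < size rs) rs`_i * x ^+ i) &
      (forall rs : seq A, (forall i, R rs`_i) ->
         \sum_(i < size rs) rs`_i * x ^+ i = 0 -> forall i, rs`_i = 0)].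

Definition ordmono (n : nat) (X : nat -> nat -> A)
    (a : {ffun 'I_2 * 'I_(2 * n) -> nat}) : A :=
  \prod_(i < 2) \prod_(j < 2 * n) X i.+1 j.+1 ^+ a (i, j).

End XDefs.

(* Main.v *)
Require Import Defs.
From HB Require Import structures.
From mathcomp Require Import all_boot all_order all_algebra.
From mathcomp Require Import boolp functions.
From mathcomp Require Import zify ring.
Import Order.TTheory GRing.Theory Num.Theory.
Local Open Scope ring_scope.
Set Implicit Arguments.
Unset Strict Implicit.
Unset Printing Implicit Defensive.

(** Relations rewrite X_m X_t (t < m) as c X_t X_m plus terms in the earlier
    generators, so the ordered monomials span, and once they are independent the
    automorphisms and derivations are read off from the unique way of writing
    X_m r = tau(r) X_m + delta(r).

    Independence is obtained from a morphism into a quantum torus, realised by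
    twisted translations acting on the functions on a lattice.  The torus has
    generators T_c, S_c, F_c, P_{c+1} (1 <= c <= n); put P_1 = 0.  The image is
    built from the innermost pair (X_{.n}, X_{.n'}) outwards:
      X_{1c'} |-> T_c,      X_{2c} |-> y_c = T_c^-1 (P_{c+1} - q P_c),
      X_{1c}  |-> S_c - q^-1 y_c n_{c+1},      X_{2c'} |-> r_c - T_c m_{c+1},
    where r_c = S_c^-1 (F_c - q P_c H_{c+1}), H_c = P_c^-2 P_{c+1} F_c,
    H_{n+1} = 1, n_c = sum_{l >= c} P_l^-1 S_l T_l and
    m_c = sum_{l >= c} P_l^-1 y_l r_l.  Here P_c is the sum of the
    q^(c-l-1) X_{1l'} X_{2l} over l < c, while P_c n_c and P_c m_c are the partial
    quadratic forms sum_{l >= c} q^(l-c) X_{rl} X_{rl'} of the two rows; n_c and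
    m_c satisfy a q-oscillator relation and act on the two rows as raising and
    lowering operators, which accounts for the non-monomial terms in the relations
    between the two rows.

    For a suitable weight on the lattice the images have leading monomials S_c, T_c,
    T_c^-1 P_{c+1}, S_c^-1 F_c, whose exponents are linearly independent. *)

(** * Subalgebras generated by initial generators *)

Section Subalgebra.
Variables (k : fieldType) (A : algType k) (g : nat -> A).
Local Notation R := (in_subalg g).

Lemma wordprod_cons t w : wordprod g (t :: w) = g t * wordprod g w.
Proof. by rewrite /wordprod big_cons. Qed.

Lemma subalg0 m : R m 0. Proof. by exists [::]; rewrite big_nil. Qed.

Lemma subalg1 m : R m 1.
Proof. by exists [:: (1, [::])]; rewrite big_seq1 scale1r /wordprod big_nil. Qed.

Lemma subalgD m y z : R m y -> R m z -> R m (y + z).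
Proof.
move=> [r [hr ->]] [s [hs ->]]; exists (r ++ s).
by rewrite all_cat hr hs big_cat.
Qed.

Lemma subalgZ m c z : R m z -> R m (c *: z).
Proof.
move=> [r [hr ->]]; exists [seq (c * p.1, p.2) | p <- r].
rewrite all_map big_map scaler_sumr; split; first exact: hr.
by apply: eq_bigr => p _; rewrite scalerA.
Qed.

Lemma subalgN m z : R m z -> R m (- z).
Proof. by rewrite -scaleN1r; exact: subalgZ. Qed.

Lemma subalg_gen m t z : (t < m)%N -> R m z -> R m (g t * z).
Proof.
move=> tm [r [hr ->]]; exists [seq (p.1, t :: p.2) | p <- r].
rewrite all_map big_map mulr_sumr; split.
  by apply/allP => p pr /=; rewrite tm; exact: (allP hr).
by apply: eq_bigr => p _; rewrite wordprod_cons scalerAr.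
Qed.

(** Words are built by left multiplication, so the products to treat are those with one generator on
    the left. Membership is carried along because most uses of the induction need it. *)
Lemma subalg_ind m (Q : A -> Prop) : Q 0 -> Q 1 ->
  (forall y z, R m y -> R m z -> Q y -> Q z -> Q (y + z)) ->
  (forall c z, R m z -> Q z -> Q (c *: z)) ->
  (forall t z, (t < m)%N -> R m z -> Q z -> Q (g t * z)) -> forall z, R m z -> Q z.
Proof.
move=> Q0 Q1 QD QZ Qg z [r [hr ->]] {z}.
have hw w : all (fun t => (t < m)%N) w -> R m (wordprod g w) /\ Q (wordprod g w).
  elim: w => [_|t w IH /= /andP[tm /IH [h1 h2]]].
    by rewrite /wordprod big_nil; split=> //; exact: subalg1.
  by rewrite wordprod_cons; split; [exact: subalg_gen | exact: Qg].
suff [] : R m (\sum_(p <- r) p.1 *: wordprod g p.2) /\ Q (\sum_(p <- r) p.1 *: wordprod g p.2).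
  by [].
elim: r hr => [_|p r IH /= /andP[/hw [h1 h2] /IH [h3 h4]]].
  by rewrite big_nil; split=> //; exact: subalg0.
rewrite big_cons; split; first by apply: subalgD => //; exact: subalgZ.
by apply: QD => //; [exact: subalgZ | exact: QZ].
Qed.

Lemma subalgM m y z : R m y -> R m z -> R m (y * z).
Proof.
move=> hy hz; elim/subalg_ind: hy => {y}.
- by rewrite mul0r; exact: subalg0.
- by rewrite mul1r.
- by move=> y y' _ _ h h'; rewrite mulrDl; exact: subalgD.
- by move=> c y _ h; rewrite -scalerAl; exact: subalgZ.
- by move=> t y tm _ h; rewrite -mulrA; exact: subalg_gen.
Qed.

Lemma subalgW m m' z : (m <= m')%N -> R m z -> R m' z.
Proof.
move=> mm [r [hr ->]]; exists r; split=> //; apply/allP => p pr.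
by apply/allP => t tp; apply: leq_trans mm; exact: (allP (allP hr p pr)).
Qed.

Lemma subalg_g m t : (t < m)%N -> R m (g t).
Proof. by move=> tm; rewrite -[g t]mulr1; apply: subalg_gen => //; exact: subalg1. Qed.

Lemma subalgX m z i : R m z -> R m (z ^+ i).
Proof.
by move=> hz; elim: i => [|i IH]; [exact: subalg1 | rewrite exprS; exact: subalgM].
Qed.

Lemma subalg_sum m (I : eqType) (s : seq I) (f : I -> A) :
  (forall i, i \in s -> R m (f i)) -> R m (\sum_(i <- s) f i).
Proof.
move=> h; rewrite big_seq; elim/big_ind: _ => //; first exact: subalg0.
by move=> *; exact: subalgD.
Qed.

Definition mono m (a : nat -> nat) : A := \prod_(0 <= t < m) g t ^+ a t.

Lemma mono_recr m a : mono m.+1 a = mono m a * g m ^+ a m.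
Proof. by rewrite /mono big_nat_recr. Qed.

Lemma eq_mono m a b : (forall t, (t < m)%N -> a t = b t) -> mono m a = mono m b.
Proof. by move=> h; rewrite /mono big_nat [RHS]big_nat; apply: eq_bigr => t /h ->. Qed.

Lemma mono_widen m M a : (m <= M)%N -> (forall t, (m <= t)%N -> a t = 0%N) ->
  mono M a = mono m a.
Proof.
move=> mM h; rewrite /mono (big_cat_nat (leq0n m) mM) //= [X in _ * X]big_nat.
by rewrite [X in _ * X]big1 ?mulr1 // => t /andP[mt _]; rewrite h.
Qed.

Lemma subalg_mono m a : R m (mono m a).
Proof.
rewrite /mono big_nat; elim/big_ind: _; first exact: subalg1.
  by move=> *; exact: subalgM.
by move=> t tm; apply/subalgX/subalg_g.
Qed.

(** * Ore extensions from reordering and independence of ordered monomials *)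

Section Ore.
Variable M : nat.
(** The remainder may involve every generator before [g m], including those between [g t] and [g m].
    The non-zero scalar [c] becomes the eigenvalue of the automorphism on [g t]. *)
Hypothesis reorder : forall m t, (t < m < M)%N ->
  exists c d, [/\ c != 0, R m d & g m * g t = c *: (g t * g m) + d].

Section Step.
Variable m : nat.
Hypothesis mM : (m < M)%N.
Local Notation x := (g m).

Lemma reorder_subalg r : R m r -> exists u v, [/\ R m u, R m v & x * r = u * x + v].
Proof.
elim/subalg_ind => [||y z _ _ [u [v [hu hv e]]] [u' [v' [hu' hv' e']]]
  |c z _ [u [v [hu hv e]]]|t z tm hz [u [v [hu hv e]]]].
- by exists 0, 0; split; rewrite ?mulr0 ?mul0r ?addr0 //; exact: subalg0.
- exists 1, 0; split; [exact: subalg1 | exact: subalg0 | by rewrite mulr1 mul1r addr0].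
- exists (u + u'), (v + v'); split; [exact: subalgD | exact: subalgD |].
  by rewrite mulrDr e e' mulrDl addrACA.
- exists (c *: u), (c *: v); split; [exact: subalgZ | exact: subalgZ |].
  by rewrite -scalerAr e scalerDr scalerAl.
- have tmM : (t < m < M)%N by rewrite tm.
  have [c [d [c0 hd ed]]] := reorder tmM.
  exists (c *: (g t * u)), (c *: (g t * v) + d * z); split.
  + by apply/subalgZ/subalg_gen.
  + by apply: subalgD; [exact/subalgZ/subalg_gen | exact: subalgM].
  + by rewrite mulrA ed mulrDl -scalerAl -mulrA e mulrDr scalerDr mulrA scalerAl addrA.
Qed.

(** Left polynomials in [x] are stable under left multiplication by every generator up to [x]:
    earlier generators act on the coefficients, and [x * f i] becomes [u * x + v] by
    [reorder_subalg]. *)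
Lemma left_poly_iff z : R m.+1 z <->
  exists d (f : nat -> A), (forall i, R m (f i)) /\ z = \sum_(i < d) f i * x ^+ i.
Proof.
split; last first.
  move=> [d [f [hf ->]]]; elim/big_ind: _; first exact: subalg0.
    by move=> *; exact: subalgD.
  move=> i _; apply: subalgM; first exact: subalgW (hf i).
  exact/subalgX/subalg_g.
pose Q z := exists d (f : nat -> A), (forall i, R m (f i)) /\ z = \sum_(i < d) f i * x ^+ i.
(* Two polynomials are added after padding both to length [d + d'] with zero coefficients. *)
have pad d e (f : nat -> A) : \sum_(i < d) f i * x ^+ i =
    \sum_(i < d + e) (if (i < d)%N then f i else 0) * x ^+ i.
  rewrite big_split_ord /= [X in _ + X]big1 ?addr0 => [|i _]; last first.
    by rewrite ltnNge leq_addr mul0r.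
  by apply: eq_bigr => i _; rewrite ltn_ord.
have QD y y' : Q y -> Q y' -> Q (y + y').
  move=> [d [f [hf ->]]] [d' [f' [hf' ->]]].
  rewrite (pad d d') (pad d' d) [(d' + d)%N]addnC -big_split /=.
  exists (d + d')%N, (fun i => (if (i < d)%N then f i else 0) + (if (i < d')%N then f' i else 0)).
  split; last by apply: eq_bigr => i _; rewrite mulrDl.
  by move=> i; apply: subalgD; case: ifP => _; rewrite ?hf ?hf' //; exact: subalg0.
have Q0 : Q 0 by exists 0%N, (fun=> 0); rewrite big_ord0; split=> // i; exact: subalg0.
have Q1 u i : R m u -> Q (u * x ^+ i).
  move=> hu; exists i.+1, (fun j => if j == i then u else 0); split.
    by move=> j; case: ifP => _ //; exact: subalg0.
  rewrite (bigD1 ord_max) //= eqxx big1 ?addr0 // => j ne.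
  by rewrite (_ : (j == i :> nat) = false) ?mul0r //; apply/negbTE.
have QS (I : Type) (s : seq I) (f : I -> A) : (forall i, Q (f i)) -> Q (\sum_(i <- s) f i).
  by move=> h; elim/big_ind: _.
elim/subalg_ind => {z} //.
- by rewrite -[1]mulr1 -[X in _ * X](expr0 x); apply/Q1/subalg1.
- by move=> *; exact: QD.
- move=> c z _ [d [f [hf ->]]]; exists d, (fun i => c *: f i); split.
    by move=> i; exact: subalgZ.
  by rewrite scaler_sumr; apply: eq_bigr => i _; rewrite scalerAl.
- move=> t z tm _ [d [f [hf ->]]]; rewrite mulr_sumr; apply: QS => i; rewrite mulrA.
  have [lt|ge] := ltnP t m; first by apply: Q1; exact: subalg_gen.
  have -> : t = m by lia.
  have [u [v [hu hv ->]]] := reorder_subalg (hf i).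
  by rewrite mulrDl -mulrA -exprS; apply: QD; exact: Q1.
Qed.
End Step.

Lemma subalg_span m : (m <= M)%N -> forall z, R m z ->
  exists r : seq (k * (nat -> nat)), z = \sum_(p <- r) p.1 *: mono m p.2.
Proof.
elim: m => [_ z [r [hr ->]]|m IH mM z].
  exists [seq (p.1, fun=> 0%N) | p <- r]; rewrite big_map; apply: eq_big_seq => p pr.
  have := allP hr p pr; case: p {pr} => c [|//] _.
  by rewrite /= /mono big_geq // /wordprod big_nil.
move/(left_poly_iff mM) => [d [f [hf ->]]].
elim: d => [|d [r IHd]]; first by exists [::]; rewrite big_ord0 big_nil.
have [s es] := IH (ltnW mM) _ (hf d).
exists (r ++ [seq (p.1, fun t => if (t < m)%N then p.2 t else d) | p <- s]).
rewrite big_ord_recr /= IHd big_cat big_map; congr (_ + _).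
rewrite es mulr_suml; apply: eq_bigr => p _ /=.
rewrite mono_recr ltnn -scalerAl; congr (_ *: (_ * _)).
by apply: eq_mono => t ->.
Qed.

Definition extend m (a : {ffun 'I_m -> nat}) (t : nat) : nat :=
  if insub t is Some i then a i else 0%N.

Lemma extend_ord m (a : {ffun 'I_m -> nat}) (i : 'I_m) : extend a i = a i.
Proof. by rewrite /extend valK. Qed.

Lemma extend_ge m (a : {ffun 'I_m -> nat}) t : (m <= t)%N -> extend a t = 0%N.
Proof. by move=> mt; rewrite /extend insubF // ltnNge mt. Qed.

Lemma extend_inj m (a b : {ffun 'I_m -> nat}) :
  (forall t, (t < m)%N -> extend a t = extend b t) -> a = b.
Proof. by move=> h; apply/ffunP => i; rewrite -!extend_ord h. Qed.

(** Terms of a spanning expression with equal exponents are collected, since independence speaks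
    only of duplicate-free lists. *)
Lemma subalg_basis m : (m <= M)%N -> forall z, R m z ->
  exists (s : seq {ffun 'I_m -> nat}) (c : {ffun 'I_m -> nat} -> k),
    uniq s /\ z = \sum_(a <- s) c a *: mono m (extend a).
Proof.
move=> mM z /(subalg_span mM) [r ->].
pose v (p : k * (nat -> nat)) := [ffun i : 'I_m => p.2 i].
exists (undup [seq v p | p <- r]), (fun a => \sum_(p <- r | v p == a) p.1).
split; first exact: undup_uniq.
under [RHS]eq_bigr do rewrite scaler_suml.
rewrite (exchange_big_dep xpredT) //= [LHS]big_seq [RHS]big_seq; apply: eq_bigr => p pr.
rewrite big_mkcond (bigD1_seq (v p)) ?undup_uniq ?eqxx //=; last by rewrite mem_undup map_f.
rewrite big1 ?addr0; last by move=> a; rewrite eq_sym; case: eqP.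
congr (_ *: _); apply: eq_mono => t tm.
by rewrite (extend_ord (v p) (Ordinal tm)) ffunE.
Qed.

(** The index type is arbitrary so that independence applies both to exponent vectors and to pairs
    of a power of [g m] and an exponent vector in the earlier generators. *)
Hypothesis free : forall (T : eqType) (s : seq T) (e : T -> nat -> nat) (c : T -> k),
  uniq s -> {in s &, forall a b, (forall t, (t < M)%N -> e a t = e b t) -> a = b} ->
  \sum_(a <- s) c a *: mono M (e a) = 0 -> {in s, forall a, c a = 0}.

Lemma mono_free m (s : seq {ffun 'I_m -> nat}) (c : {ffun 'I_m -> nat} -> k) : (m <= M)%N ->
  uniq s -> \sum_(a <- s) c a *: mono m (extend a) = 0 -> {in s, forall a, c a = 0}.
Proof.
move=> mM us h; apply: (free (e := @extend m)) => // [a b _ _ e|].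
  by apply: extend_inj => t tm; apply: e; exact: leq_trans mM.
by rewrite -[RHS]h; apply: eq_bigr => a _; rewrite (mono_widen mM) // => t; exact: extend_ge.
Qed.

(** Expanding each coefficient in ordered monomials gives a combination of ordered monomials in
    [g 0], ..., [g m]. The pairs of a power of [g m] and a coefficient exponent give distinct
    monomials, so all scalars vanish. *)
Lemma left_poly_free m d (f : nat -> A) : (m < M)%N -> (forall i, R m (f i)) ->
  \sum_(i < d) f i * g m ^+ i = 0 -> forall i, (i < d)%N -> f i = 0.
Proof.
move=> mM hf h i0 i0d.
have [s hs] := choice (fun i => subalg_basis (ltnW mM) (hf i)).
have [c hc] := choice hs.
pose T := (nat * {ffun 'I_m -> nat})%type.
pose L : seq T := [seq (i, a) | i <- iota 0 d, a <- s i].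
pose e (p : T) t := if (t < m)%N then extend p.2 t else if t == m then p.1 else 0%N.
have uL : uniq L.
  apply: allpairs_uniq_dep => [|i _|]; [exact: iota_uniq | by have [] := hc i |].
  by move=> [i a] [j b] _ _ /= [-> ->].
have ez p : mono M (e p) = mono m (extend p.2) * g m ^+ p.1.
  rewrite (@mono_widen m.+1) // => [|t mt].
    by rewrite mono_recr /e ltnn eqxx; congr (_ * _); apply: eq_mono => t ->.
  by rewrite /e ltnNge (ltnW mt) /= gtn_eqF.
have zL := free (s := L) (e := e) (c := fun p => c p.1 p.2) uL.
have [_ ->] := hc i0; rewrite big1_seq // => a /andP[_ ha].
rewrite (zL _ _ (i0, a)) ?scale0r //=.
- move=> [i a'] [j b] _ _ hh; congr (_, _).
    by have := hh m mM; rewrite /e ltnn eqxx.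
  by apply: extend_inj => t tm; have := hh t (ltn_trans tm mM); rewrite /e tm.
- rewrite big_allpairs_dep /= -[RHS]h -(big_mkord xpredT (fun i => f i * g m ^+ i)).
  rewrite /index_iota subn0; apply: eq_bigr => i _.
  have [_ ei] := hc i; rewrite ei mulr_suml; apply: eq_bigr => b _.
  by rewrite ez -scalerAl.
- by apply/allpairsPdep; exists i0, a; split=> //; rewrite mem_iota.
Qed.

Lemma left_poly1_inj m u v u' v' : (m < M)%N -> R m u -> R m v -> R m u' -> R m v' ->
  u * g m + v = u' * g m + v' -> u = u' /\ v = v'.
Proof.
move=> mM hu hv hu' hv' e.
pose f i := if i == 0%N then v - v' else if i == 1%N then u - u' else 0.
have hf i : R m (f i).
  rewrite /f; do 2 (case: ifP => _; first by apply: subalgD => //; exact: subalgN).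
  exact: subalg0.
have := @left_poly_free m 2 f mM hf.
rewrite big_ord_recl big_ord1 /f /= expr0 expr1 mulr1 mulrBl addrC.
rewrite [X in X = 0](_ : _ = (u * g m + v) - (u' * g m + v')); last first.
  by rewrite opprD addrACA.
rewrite e subrr => /(_ erefl) h.
by split; apply/eqP; rewrite -subr_eq0; apply/eqP; [exact: (h 1%N) | exact: (h 0%N)].
Qed.

(** Existence of [u * g m + v] defines [tau] and [del], and its uniqueness forces all their
    algebraic identities. Bijectivity of [tau] comes from its scaling each earlier generator by a
    non-zero scalar. *)
Theorem ore_ext m : (m < M)%N -> is_ore_ext (R m) (R m.+1) (g m).
Proof.
move=> mM.
(* The condition is put inside the existential so that choice yields functions on all of [A];
   outside [R m] their values are arbitrary. *)
have ex r : exists p : A * A, R m r -> [/\ R m p.1, R m p.2 & g m * r = p.1 * g m + p.2].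
  have [hr|nr] := pselect (R m r); last by exists (0, 0).
  by have [u [v [hu hv e]]] := reorder_subalg mM hr; exists (u, v).
have [F hF] := choice ex.
pose tau r := (F r).1; pose del r := (F r).2.
have ht r : R m r -> R m (tau r) by move/hF => [].
have hd r : R m r -> R m (del r) by move/hF => [].
have he r : R m r -> g m * r = tau r * g m + del r by move/hF => [].
have uni r u v : R m r -> R m u -> R m v -> g m * r = u * g m + v -> tau r = u /\ del r = v.
  move=> hr hu hv e; apply: left_poly1_inj (ht _ hr) (hd _ hr) hu hv _ => //.
  by rewrite -he.
have tD r r' : R m r -> R m r' -> tau (r + r') = tau r + tau r' /\ del (r + r') = del r + del r'.
  move=> hr hr'; apply: uni; do ?by apply: subalgD; auto.
  by rewrite mulrDr !he // mulrDl addrACA.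
have tZ c r : R m r -> tau (c *: r) = c *: tau r /\ del (c *: r) = c *: del r.
  move=> hr; apply: uni; do ?by apply: subalgZ; auto.
  by rewrite -scalerAr he // scalerDr scalerAl.
have tM r r' : R m r -> R m r' ->
    tau (r * r') = tau r * tau r' /\ del (r * r') = tau r * del r' + del r * r'.
  move=> hr hr'; apply: uni.
  - exact: subalgM.
  - by apply: subalgM; auto.
  - by apply: subalgD; apply: subalgM; auto.
  by rewrite mulrA he // mulrDl -mulrA he // mulrDr mulrA addrA.
have t1 : tau 1 = 1.
  by have [] := uni 1 1 0 (subalg1 m) (subalg1 m) (subalg0 m); rewrite ?mulr1 ?mul1r ?addr0.
have t0 : tau 0 = 0.
  by have [] := uni 0 0 0 (subalg0 m) (subalg0 m) (subalg0 m); rewrite ?mulr0 ?mul0r ?addr0.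
have tg t : (t < m)%N -> exists2 c, c != 0 & tau (g t) = c *: g t.
  move=> tm; have tmM : (t < m < M)%N by rewrite tm.
  have [c [d [c0 hc e]]] := reorder tmM.
  have hg := subalg_g tm; exists c => //.
  by have [] := uni (g t) (c *: g t) d hg (subalgZ c hg) hc; rewrite // e scalerAl.
have tX t i : (t < m)%N -> exists2 c, c != 0 & tau (g t ^+ i) = c *: g t ^+ i.
  move=> tm; have [c c0 e] := tg t tm; exists (c ^+ i); first exact: expf_neq0.
  elim: i => [|i IH]; first by rewrite !expr0 scale1r.
  rewrite !exprS; have [-> _] := tM (g t) (g t ^+ i) (subalg_g tm) (subalgX _ (subalg_g tm)).
  by rewrite e IH -scalerAl -scalerAr scalerA.
have tmono a : exists2 c, c != 0 & tau (mono m a) = c *: mono m a.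
  have : (m <= m)%N by [].
  elim: {1 3 4}m => [_|n IH nm]; first by exists 1; rewrite ?oner_eq0 // /mono big_geq // scale1r.
  have [c c0 e] := IH (ltnW nm); have [c' c'0 e'] := tX n (a n) nm.
  exists (c * c'); first by rewrite mulf_neq0.
  rewrite mono_recr; have [-> _] := tM (mono n a) (g n ^+ a n)
    (subalgW (ltnW nm) (subalg_mono n a)) (subalgX _ (subalg_g nm)).
  by rewrite e e' -scalerAl -scalerAr scalerA.
(* On the ordered monomials [tau] is diagonal with non-zero eigenvalues, so their independence makes
   it injective. *)
have tinj r : R m r -> tau r = 0 -> r = 0.
  move=> hr; have [s [c [us er]]] := subalg_basis (ltnW mM) hr.
  have [l l0 el] : exists2 l : {ffun 'I_m -> nat} -> k, forall a, l a != 0 &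
      forall a, tau (mono m (extend a)) = l a *: mono m (extend a).
    have : forall a : {ffun 'I_m -> nat}, exists l, l != 0 /\
        tau (mono m (extend a)) = l *: mono m (extend a).
      by move=> a; have [l ? ?] := tmono (extend a); exists l.
    by move/choice => [l hl]; exists l => a; have [] := hl a.
  have -> : tau r = \sum_(a <- s) (c a * l a) *: mono m (extend a).
    rewrite er; elim: (s) => [|a s' IH]; first by rewrite !big_nil.
    rewrite !big_cons; have [-> _] := tD (c a *: mono m (extend a))
      (\sum_(j <- s') c j *: mono m (extend j))
      (subalgZ _ (subalg_mono m (extend a)))
      (subalg_sum (fun j _ => subalgZ (c j) (subalg_mono m (extend j)))).
    rewrite IH; have [-> _] := tZ (c a) _ (subalg_mono m (extend a)).
    by rewrite el scalerA.
  move/(mono_free (ltnW mM) us) => h0; rewrite er big1_seq // => a /andP[_ ha].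
  by have /eqP := h0 a ha; rewrite mulf_eq0 (negPf (l0 a)) orbF => /eqP ->; rewrite scale0r.
exists tau, del; split.
- split; first exact: ht.
  split.
    (* Preimages are built along words: if [z'] is sent to [z], then [c^-1 *: (g t * z')] is sent to
       [g t * z]. *)
    move=> r; elim/subalg_ind => [||y z _ _ [y' [hy ey]] [z' [hz ez]]
        |c z _ [z' [hz ez]]|t z tm hz [z' [hz' ez]]].
    + by exists 0; split=> //; exact: subalg0.
    + by exists 1; split=> //; exact: subalg1.
    + by exists (y' + z'); split; [exact: subalgD | rewrite (tD _ _ hy hz).1 ey ez].
    + by exists (c *: z'); split; [exact: subalgZ | rewrite (tZ _ _ hz).1 ez].
    + have [c c0 e] := tg t tm; exists (c^-1 *: (g t * z')).
      split; first exact/subalgZ/subalg_gen.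
      rewrite (tZ _ _ (subalg_gen tm hz')).1 (tM _ _ (subalg_g tm) hz').1 e ez.
      by rewrite -scalerAl scalerA mulVf // scale1r.
  split.
    move=> r r' hr hr' e; apply/eqP; rewrite -subr_eq0; apply/eqP/tinj.
      by apply: subalgD => //; exact: subalgN.
    rewrite -scaleN1r; have [-> _] := tD r (-1 *: r') hr (subalgZ _ hr').
    by have [-> _] := tZ (-1) _ hr'; rewrite e scaleN1r subrr.
  split; first by move=> r r' hr hr'; have [] := tD r r' hr hr'.
  split; first by move=> r r' hr hr'; have [] := tM r r' hr hr'.
  by split=> // c r hr; have [] := tZ c r hr.
- split=> //.
  + by move=> r r' hr hr'; have [] := tD r r' hr hr'.
  + by move=> c r hr; have [] := tZ c r hr.
  + by move=> r r' hr hr'; have [] := tM r r' hr hr'.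
- exact: he.
- move=> z; split=> [/(left_poly_iff mM) [d [f [hf ->]]]|[rs [hrs ->]]].
    exists (mkseq f d); rewrite size_mkseq; split=> [i|].
      have [lt|ge] := ltnP i d; first by rewrite nth_mkseq.
      by rewrite nth_default ?size_mkseq //; exact: subalg0.
    by apply: eq_bigr => i _; rewrite nth_mkseq.
  by apply/(left_poly_iff mM); exists (size rs), (fun i => rs`_i).
- move=> rs hrs h i; have [lt|ge] := ltnP i (size rs); last by rewrite nth_default.
  exact: (@left_poly_free m (size rs) (fun i => rs`_i)).
Qed.
End Ore.
End Subalgebra.

(** * Linear combinations *)

Section LinearCombinations.
Variables (k : pzRingType) (V : lmodType k).

(** Syntax for proof by reflection: an identity between linear combinations of atoms is reduced to
    one scalar identity per atom, whatever the order of the terms. *)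
Inductive lexp :=
  LVar of nat | LZero | LAdd of lexp & lexp | LOpp of lexp | LScale of k & lexp.

Fixpoint leval (env : seq V) (e : lexp) : V :=
  match e with
  | LVar i => env`_i
  | LZero => 0
  | LAdd a b => leval env a + leval env b
  | LOpp a => - leval env a
  | LScale c a => c *: leval env a
  end.

Fixpoint lcoef (e : lexp) (i : nat) : k :=
  match e with
  | LVar j => if i == j then 1 else 0
  | LZero => 0
  | LAdd a b => lcoef a i + lcoef b i
  | LOpp a => - lcoef a i
  | LScale c a => c * lcoef a i
  end.

Fixpoint lcoef_eq (a b : lexp) (i : nat) : Prop :=
  if i is j.+1 then lcoef a j = lcoef b j /\ lcoef_eq a b j else True.

Lemma levalE env e : leval env e = \sum_(i < size env) lcoef e i *: env`_i.
Proof.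
elim: e => [j||a IHa b IHb|a IH|c a IH] /=.
- have [jlt|jge] := ltnP j (size env).
    rewrite (bigD1 (Ordinal jlt)) //= eqxx scale1r big1 ?addr0 // => i ne.
    by rewrite ifN ?scale0r.
  rewrite nth_default // big1 // => i _; rewrite ifN ?scale0r //.
  by have := ltn_ord i; lia.
- by rewrite big1 // => i _; rewrite scale0r.
- by rewrite IHa IHb -big_split; apply: eq_bigr => i _; rewrite scalerDl.
- by rewrite IH -sumrN; apply: eq_bigr => i _; rewrite scaleNr.
- by rewrite IH scaler_sumr; apply: eq_bigr => i _; rewrite scalerA.
Qed.

Lemma leval_eq env a b : lcoef_eq a b (size env) -> leval env a = leval env b.
Proof.
rewrite !levalE => h; apply: eq_bigr => i _; congr (_ *: _).
elim: (size env) i h => [[]//|N IH] i /= [e h].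
have [ilt|] := ltnP i N; first exact: (IH (Ordinal ilt)).
by move=> ?; have -> : (i : nat) = N by have := ltn_ord i; lia.
Qed.
End LinearCombinations.

Ltac lin_mem x l :=
  match l with
  | nil => constr:(false)
  | cons ?y _ => let u := match goal with _ => unify x y end in constr:(true)
  | cons _ ?l' => lin_mem x l'
  end.
Ltac lin_env e l :=
  match e with
  | (?a + ?b)%R => let l' := lin_env a l in lin_env b l'
  | (- ?a)%R => lin_env a l
  | (?c *: ?a)%R => lin_env a l
  | 0%R => l
  | _ => let r := lin_mem e l in
         match r with true => l | false => constr:(cons e l) end
  end.
(* Monomials are compared up to conversion, since the instance paths hidden in
   their products differ. *)
Ltac lin_index x l :=
  match l with
  | cons ?y _ => let u := match goal with _ => unify x y end in constr:(0%N)
  | cons _ ?l' => let i := lin_index x l' in constr:(S i)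
  end.
Ltac lin_reify K e l :=
  match e with
  | (?a + ?b)%R =>
    let a' := lin_reify K a l in let b' := lin_reify K b l in constr:(@LAdd K a' b')
  | (- ?a)%R => let a' := lin_reify K a l in constr:(@LOpp K a')
  | (?c *: ?a)%R => let a' := lin_reify K a l in constr:(@LScale K c a')
  | 0%R => constr:(@LZero K)
  | _ => let i := lin_index e l in constr:(@LVar K i)
  end.
Ltac lin_split K :=
  match goal with |- @eq ?T ?a ?b =>
    let l := lin_env a (@nil T) in let l := lin_env b l in
    let a' := lin_reify K a l in let b' := lin_reify K b l in
    apply: (@leval_eq K _ l a' b'); rewrite /=; repeat split
  end.

(** * Commutation up to a power of q *)

Section QCommutation.
Variables (k : fieldType) (B : algType k) (q : k).
Hypothesis q0 : q != 0.
Implicit Types (X Y Z : B) (a b : int).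

(** Integer exponents make the weight additive in products and odd under inversion. The zero element
    has every weight, so that P_1 = 0 needs no separate treatment. *)
Definition qc a Z X := Z * X = q ^ a *: (X * Z).

Lemma qc0 Z X : qc 0 Z X -> Z * X = X * Z.
Proof. by rewrite /qc expr0z scale1r. Qed.

Lemma qc_refl Z : qc 0 Z Z.
Proof. by rewrite /qc expr0z scale1r. Qed.

Lemma qc_zero a Z : qc a Z 0.
Proof. by rewrite /qc mulr0 mul0r scaler0. Qed.

Lemma qc_zerol a X : qc a 0 X.
Proof. by rewrite /qc mulr0 mul0r scaler0. Qed.

Lemma qc_one Z : qc 0 Z 1.
Proof. by rewrite /qc mulr1 mul1r expr0z scale1r. Qed.

Lemma qc_sym a Z X : qc a Z X -> qc (- a) X Z.
Proof. by rewrite /qc => ->; rewrite scalerA -expfzDr // addNr expr0z scale1r. Qed.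

Lemma qcD a Z X Y : qc a Z X -> qc a Z Y -> qc a Z (X + Y).
Proof. by rewrite /qc mulrDr mulrDl scalerDr => -> ->. Qed.

Lemma qcN a Z X : qc a Z X -> qc a Z (- X).
Proof. by rewrite /qc mulrN mulNr scalerN => ->. Qed.

Lemma qcB a Z X Y : qc a Z X -> qc a Z Y -> qc a Z (X - Y).
Proof. by move=> hX hY; apply/qcD/qcN. Qed.

Lemma qcZ a c Z X : qc a Z X -> qc a Z (c *: X).
Proof. by rewrite /qc -scalerAr -scalerAl => ->; rewrite !scalerA mulrC. Qed.

Lemma qcM a b Z X Y : qc a Z X -> qc b Z Y -> qc (a + b) Z (X * Y).
Proof.
rewrite /qc => hX hY; rewrite mulrA hX -scalerAl -(mulrA X Z Y) hY -scalerAr scalerA mulrA.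
by rewrite -expfzDr.
Qed.

Lemma qcV a Z X Xi : X * Xi = 1 -> Xi * X = 1 -> qc a Z X -> qc (- a) Z Xi.
Proof.
move=> h1 h2 /qc_sym; rewrite /qc => h; rewrite -[Z in LHS]mul1r -{1}h2 -(mulrA Xi) h.
by rewrite -scalerAr -scalerAl !mulrA -(mulrA (Xi * Z)) h1 mulr1.
Qed.

Lemma qc_sum a Z (I : Type) (r : seq I) (p : pred I) (f : I -> B) :
  (forall i, p i -> qc a Z (f i)) -> qc a Z (\sum_(i <- r | p i) f i).
Proof. by move=> h; elim/big_ind: _ => //; [exact: qc_zero | exact: qcD]. Qed.

Lemma qcl a Z X : qc a Z X -> Z * X = q ^ a *: (X * Z). Proof. by []. Qed.

Lemma qcA a Z X : qc a Z X -> forall Y, Z * (X * Y) = q ^ a *: (X * (Z * Y)).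
Proof. by move=> h Y; rewrite mulrA h -scalerAl mulrA. Qed.
End QCommutation.

(** * Passing from level c + 1 to level c *)

Section Step.
Variables (k : fieldType) (B : algType k) (q : k).
Hypothesis q0 : q != 0.

(* Level c of the tower: O = P_c, H = H_{c+1}, s = S_c, t = T_c, r = r_c, y = y_c,
   n = n_{c+1}, m = m_{c+1}.  Below, x and w are the images of X_{1c} and X_{2c'},
   and n', m', H' are n_c, m_c, H_c. *)
Record step_rel (O H s r t y n m : B) : Prop := StepRel {
  rel_H_O : qc q 0 H O;
  rel_s_O : qc q 1 s O;
  rel_s_H : qc q 0 s H;
  rel_r_O : qc q (-1) r O;
  rel_r_H : qc q 0 r H;
  rel_t_O : qc q 1 t O;
  rel_t_H : qc q 0 t H;
  rel_t_s : qc q 0 t s;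
  rel_t_r : qc q 1 t r;
  rel_y_O : qc q (-1) y O;
  rel_y_H : qc q 0 y H;
  rel_y_s : qc q (-1) y s;
  rel_y_r : qc q 0 y r;
  rel_n_O : qc q 2 n O;
  rel_n_H : qc q (-4) n H;
  rel_n_s : qc q (-1) n s;
  rel_n_r : qc q (-1) n r;
  rel_n_t : qc q 1 n t;
  rel_n_y : qc q 1 n y;
  rel_m_O : qc q (-2) m O;
  rel_m_H : qc q 4 m H;
  rel_m_s : qc q 1 m s;
  rel_m_r : qc q 1 m r;
  rel_m_t : qc q (-1) m t;
  rel_m_y : qc q (-1) m y;
  rel_r_s : r * s = q *: (s * r) + (q ^+ 2 - 1) *: (O * H);
  rel_y_t : y * t = q *: (t * y) + (q ^+ 2 - 1) *: O;
  rel_m_n : m * n = q ^+ 2 *: (n * m) + (q * (q ^+ 2 - 1)) *: (H - 1) }.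

Variables O H s r t y n m : B.
Hypothesis rel : step_rel O H s r t y n m.

(* Used as rewriting rules, the relations sort every word into the order
   Oi, O, H, s, r, t, y, n, m, which is a normal form. *)
Let r_sA Z : r * (s * Z) = q *: (s * (r * Z)) + (q ^+ 2 - 1) *: (O * (H * Z)).
Proof. by rewrite mulrA (rel_r_s rel) mulrDl -!scalerAl ?mulrBl ?mul1r -!mulrA. Qed.
Let y_tA Z : y * (t * Z) = q *: (t * (y * Z)) + (q ^+ 2 - 1) *: (O * Z).
Proof. by rewrite mulrA (rel_y_t rel) mulrDl -!scalerAl ?mulrBl ?mul1r -!mulrA. Qed.
Let m_nA Z : m * (n * Z) = q ^+ 2 *: (n * (m * Z)) + (q * (q ^+ 2 - 1)) *: (H * Z - Z).
Proof. by rewrite mulrA (rel_m_n rel) mulrDl -!scalerAl ?mulrBl ?mul1r -!mulrA. Qed.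
Let ordl :=
  (qcl (rel_H_O rel), qcl (rel_s_O rel), qcl (rel_s_H rel), qcl (rel_r_O rel),
   qcl (rel_r_H rel), qcl (rel_t_O rel), qcl (rel_t_H rel), qcl (rel_t_s rel),
   qcl (rel_t_r rel), qcl (rel_y_O rel), qcl (rel_y_H rel), qcl (rel_y_s rel),
   qcl (rel_y_r rel), qcl (rel_n_O rel), qcl (rel_n_H rel), qcl (rel_n_s rel),
   qcl (rel_n_r rel), qcl (rel_n_t rel), qcl (rel_n_y rel), qcl (rel_m_O rel),
   qcl (rel_m_H rel), qcl (rel_m_s rel), qcl (rel_m_r rel), qcl (rel_m_t rel),
   qcl (rel_m_y rel), rel_r_s rel, rel_y_t rel, rel_m_n rel).
Let ordr :=
  (qcA (rel_H_O rel), qcA (rel_s_O rel), qcA (rel_s_H rel), qcA (rel_r_O rel),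
   qcA (rel_r_H rel), qcA (rel_t_O rel), qcA (rel_t_H rel), qcA (rel_t_s rel),
   qcA (rel_t_r rel), qcA (rel_y_O rel), qcA (rel_y_H rel), qcA (rel_y_s rel),
   qcA (rel_y_r rel), qcA (rel_n_O rel), qcA (rel_n_H rel), qcA (rel_n_s rel),
   qcA (rel_n_r rel), qcA (rel_n_t rel), qcA (rel_n_y rel), qcA (rel_m_O rel),
   qcA (rel_m_H rel), qcA (rel_m_s rel), qcA (rel_m_r rel), qcA (rel_m_t rel),
   qcA (rel_m_y rel), r_sA, y_tA, m_nA).

Ltac expand := rewrite ?(mulrDl, mulrDr, mulNr, mulrN, =^~scalerAl, =^~scalerAr, scalerDr,
  scalerN, scalerA, mul1r, mulr1, =^~mulrA, opprD, opprK).
Ltac exprz_eval := repeat match goal with |- context [exprz ?u ?e] =>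
    let v := eval compute in e in
    match v with
    | Posz ?i => change (exprz u e) with (u ^+ i)
    | Negz ?i => change (exprz u e) with (u ^- i.+1)
    end
  end.
(** Both sides are brought to normal form and compared word by word; each coefficient comparison is
    a field identity in [q]. *)
Ltac qring_with l r :=
  repeat (expand; progress rewrite ?r ?l); expand; exprz_eval; lin_split k; by field.
Ltac qring := qring_with ordl ordr.

(** [P] is P_{c+1}, rewritten through y_c = T_c^-1 (P_{c+1} - q P_c), and [K] is P_{c+1} (H_{c+1} -
    q n_{c+1} m_{c+1}), which accounts for the mixed quadratic terms of the last relation. *)
Let P := t * y + q *: O.
Let K := P * (H - q *: (n * m)).
Let x := s - q^-1 *: (y * n).
Let w := r - t * m.
Local Notation qh := (q - q^-1).

Lemma step_tx : t * x = x * t + qh *: (P * n).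
Proof. rewrite /x /P. qring. Qed.
Lemma step_wy : w * y = y * w + qh *: (P * m).
Proof. rewrite /w /P. qring. Qed.
Lemma step_yx : y * x = q^-1 *: (x * y).
Proof. rewrite /x. qring. Qed.
Lemma step_wt : w * t = q^-1 *: (t * w).
Proof. rewrite /w. qring. Qed.
Lemma step_wx : w * x = q *: (x * w) - qh *: (t * y) + qh *: K.
Proof. rewrite /w /x /K /P. qring. Qed.

Variable Oi : B.
Hypotheses (Oi_O : Oi * O = 1) (O_Oi : O * Oi = 1).
Let Oi_OA Z : Oi * (O * Z) = Z. Proof. by rewrite mulrA Oi_O mul1r. Qed.
Let O_OiA Z : O * (Oi * Z) = Z. Proof. by rewrite mulrA O_Oi mul1r. Qed.
Let qcOi a Z : qc q a Z O -> qc q (- a) Z Oi. Proof. exact: (qcV q0 O_Oi Oi_O). Qed.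
Let ordli :=
  (Oi_O, O_Oi, qcl (qcOi (rel_H_O rel)), qcl (qcOi (rel_s_O rel)), qcl (qcOi (rel_r_O rel)),
   qcl (qcOi (rel_t_O rel)), qcl (qcOi (rel_y_O rel)), qcl (qcOi (rel_n_O rel)),
   qcl (qcOi (rel_m_O rel)), ordl).
Let ordri :=
  (Oi_OA, O_OiA, qcA (qcOi (rel_H_O rel)), qcA (qcOi (rel_s_O rel)),
   qcA (qcOi (rel_r_O rel)), qcA (qcOi (rel_t_O rel)), qcA (qcOi (rel_y_O rel)),
   qcA (qcOi (rel_n_O rel)), qcA (qcOi (rel_m_O rel)), ordr).
Ltac qringi := qring_with ordli ordri.

Let n' := Oi * (s * t) + n.
Let m' := Oi * (y * r) + m.
Let H' := Oi * (Oi * (P * (s * r + q *: (O * H)))).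

(** This and the next two identities are the recursions that unroll P_c n_c, P_c m_c and P_c (H_c -
    q n_c m_c) into quadratic sums in the generators. *)
Lemma step_N : O * n' = x * t + q *: (P * n).
Proof. rewrite /n' /x /P. qringi. Qed.
Lemma step_M : O * m' = y * w + q *: (P * m).
Proof. rewrite /m' /w /P. qringi. Qed.
Lemma step_K : O * (H' - q *: (n' * m')) = q *: (x * w + K).
Proof. rewrite /n' /m' /H' /K /w /x /P. qringi. Qed.
Lemma step_nt : n' * t = q *: (t * n').
Proof. rewrite /n'. qringi. Qed.
Lemma step_nx : n' * x = q *: (x * n').
Proof. rewrite /n' /x. qringi. Qed.
Lemma step_my : m' * y = q^-1 *: (y * m').
Proof. rewrite /m'. qringi. Qed.
Lemma step_mw : m' * w = q^-1 *: (w * m').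
Proof. rewrite /m' /w. qringi. Qed.
(** In this and the next three identities n_c raises the second row to the first (y to x, w to t)
    and m_c lowers the first row to the second (x to y, t to w). *)
Lemma step_yn : y * n' = q *: (n' * y) + (q * (q ^+ 2 - 1)) *: x.
Proof. rewrite /n' /x. qringi. Qed.
Lemma step_wn : w * n' = q *: (n' * w) + (q * (q ^+ 2 - 1)) *: t.
Proof. rewrite /n' /w. qringi. Qed.
Lemma step_mx : m' * x = q *: (x * m') + qh *: y.
Proof. rewrite /m' /x. qringi. Qed.
Lemma step_mt : m' * t = q *: (t * m') + qh *: w.
Proof. rewrite /m' /w. qringi. Qed.
(** The q-oscillator relation passes from n_{c+1}, m_{c+1}, H_{c+1} to n_c, m_c, H_c; this drives
    the descending induction. *)
Lemma step_mn :
  m' * n' = q ^+ 2 *: (n' * m') + (q * (q ^+ 2 - 1)) *: (H' - 1).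
Proof. rewrite /m' /n' /H' /P. qringi. Qed.
End Step.

(** * The tower of levels *)

Section Tower.
Variables (k : fieldType) (B : algType k) (q : k).
Hypothesis q0 : q != 0.
Variable N : nat.
Local Notation qh := (q - q^-1).
Local Notation rng c := (0 < c <= N.+1)%N.

Record torus_rel (T S P F : nat -> B) : Prop := TorusRel {
  rel_TT : forall c d, rng c -> rng d -> (c < d)%N -> qc q (-1) (T c) (T d);
  rel_TS : forall c d, rng c -> rng d -> qc q (if c == d then 0 else -1) (T c) (S d);
  rel_SS : forall c d, rng c -> rng d -> (c < d)%N -> qc q 1 (S c) (S d);
  rel_PT : forall c d, rng c -> rng d -> qc q (if (c <= d)%N then -1 else 1) (P c) (T d);
  rel_PS : forall c d, rng c -> rng d -> qc q (-1) (P c) (S d);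
  rel_PP : forall c d, rng c -> rng d -> qc q 0 (P c) (P d);
  rel_PF : forall c d, rng c -> rng d -> qc q 0 (P c) (F d);
  rel_FT : forall c d, rng c -> rng d -> qc q (if c == d then -1 else 1) (F c) (T d);
  rel_FS : forall c d, rng c -> rng d -> qc q (if (c <= d)%N then 1 else -1) (F c) (S d);
  rel_FF : forall c d, rng c -> rng d -> qc q 0 (F c) (F d) }.

Variables T S P F Ti Si Pi : nat -> B.
Hypothesis rel : torus_rel T S P F.
Hypotheses (T_Ti : forall c, rng c -> T c * Ti c = 1) (Ti_T : forall c, rng c -> Ti c * T c = 1).
Hypotheses (S_Si : forall c, rng c -> S c * Si c = 1) (Si_S : forall c, rng c -> Si c * S c = 1).
Hypotheses (P_Pi : forall c, (1 < c <= N.+1)%N -> P c * Pi c = 1)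
           (Pi_P : forall c, (1 < c <= N.+1)%N -> Pi c * P c = 1).
Hypothesis P1 : P 1 = 0.

(* The hypothesis P 1 = 0 makes the level recursion start at c = 1; Pi 1 is junk. *)
Definition tow_y c := Ti c * (P c.+1 - q *: P c).
Definition tow_H c := if c == N.+1 then 1 else Pi c * (Pi c * (P c.+1 * F c)).
Definition tow_r c := Si c * (F c - q *: (P c * tow_H c.+1)).
Definition tow_n c := \sum_(c <= l < N.+1) Pi l * (S l * T l).
Definition tow_m c := \sum_(c <= l < N.+1) Pi l * (tow_y l * tow_r l).
Definition tow_x c := S c - q^-1 *: (tow_y c * tow_n c.+1).
Definition tow_w c := tow_r c - T c * tow_m c.+1.
Definition tow_K c := P c * (tow_H c - q *: (tow_n c * tow_m c)).
Definition tow_X (r j : nat) :=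
  if r == 1%N then if (j <= N)%N then tow_x j else T ((2 * N).+1 - j)
  else if (j <= N)%N then tow_y j else tow_w ((2 * N).+1 - j).

Lemma qcE a b (Z X : B) : a = b -> qc q b Z X -> qc q a Z X. Proof. by move=> ->. Qed.

Section Weights.
Variables (Z : B) (c : nat) (a b : int).
Hypothesis c0 : (0 < c)%N.
Hypothesis ZT : forall d, (c <= d <= N)%N -> qc q a Z (T d).
Hypothesis ZS : forall d, (c <= d <= N)%N -> qc q a Z (S d).
Hypothesis ZP : forall d, (c <= d <= N.+1)%N -> qc q (a + b) Z (P d).
Hypothesis ZF : forall d, (c <= d <= N)%N -> qc q (a + b) Z (F d).

Let ZTi d : (c <= d <= N)%N -> qc q (- a) Z (Ti d).
Proof. by move=> hd; apply: (qcV q0 (T_Ti _) (Ti_T _) (ZT hd)); lia. Qed.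
Let ZSi d : (c <= d <= N)%N -> qc q (- a) Z (Si d).
Proof. by move=> hd; apply: (qcV q0 (S_Si _) (Si_S _) (ZS hd)); lia. Qed.
Let ZPi d : (c <= d <= N.+1)%N -> (1 < d)%N -> qc q (- (a + b)) Z (Pi d).
Proof. by move=> hd d1; apply: (qcV q0 (P_Pi _) (Pi_P _) (ZP hd)); lia. Qed.

(** From here to the end of the section weights are counted as in a bigrading: [a] for the first
    row, [b] for the second. Thus P and F have weight a + b, H has 0, n has a - b and m has b -
    a. *)
Lemma weight_y d : (c <= d <= N)%N -> qc q b Z (tow_y d).
Proof.
move=> hd; apply: (@qcE _ (- a + (a + b))); first lia.
by apply: qcM => //; [exact: ZTi | apply: qcB; last apply: qcZ; apply: ZP; lia].
Qed.

Lemma weight_H d : (c <= d <= N.+1)%N -> (1 < d)%N -> qc q 0 Z (tow_H d).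
Proof.
move=> hd d1; rewrite /tow_H; case: eqP => [_|ne]; first exact: qc_one.
apply: (@qcE _ (- (a + b) + (- (a + b) + ((a + b) + (a + b))))); first lia.
by apply: (qcM q0 (ZPi _ _)) => //; apply: (qcM q0 (ZPi _ _)) => //;
   apply: qcM => //; [apply: ZP | apply: ZF]; lia.
Qed.

Lemma weight_r d : (c <= d <= N)%N -> qc q b Z (tow_r d).
Proof.
move=> hd; apply: (@qcE _ (- a + (a + b))); first lia.
apply: qcM => //; first exact: ZSi.
apply: qcB; first exact: ZF.
apply: qcZ; rewrite -[a + b]addr0; apply: qcM => //; first by apply: ZP; lia.
by apply: weight_H; lia.
Qed.

Lemma weight_n d : (c <= d)%N -> (1 < d)%N -> qc q (a - b) Z (tow_n d).
Proof.
move=> hd d1; rewrite /tow_n big_nat; apply: qc_sum => l hl.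
apply: (@qcE _ (- (a + b) + (a + a))); first lia.
by apply: (qcM q0 (ZPi _ _)); try lia; apply: qcM => //; [apply: ZS | apply: ZT]; lia.
Qed.

Lemma weight_m d : (c <= d)%N -> (1 < d)%N -> qc q (b - a) Z (tow_m d).
Proof.
move=> hd d1; rewrite /tow_m big_nat; apply: qc_sum => l hl.
apply: (@qcE _ (- (a + b) + (b + b))); first lia.
by apply: (qcM q0 (ZPi _ _)); try lia; apply: qcM => //; [apply: weight_y | apply: weight_r]; lia.
Qed.

Lemma weight_x d : (c <= d <= N)%N -> qc q a Z (tow_x d).
Proof.
move=> hd; apply: qcB; first exact: ZS.
apply/qcZ/(@qcE _ (b + (a - b))); first lia.
by apply: qcM => //; [exact: weight_y | apply: weight_n; lia].
Qed.

Lemma weight_w d : (c <= d <= N)%N -> qc q b Z (tow_w d).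
Proof.
move=> hd; apply: qcB; first exact: weight_r.
apply: (@qcE _ (a + (b - a))); first lia.
by apply: qcM => //; [exact: ZT | apply: weight_m; lia].
Qed.

Lemma weight_X1 j : (c <= j <= (2 * N).+1 - c)%N -> qc q a Z (tow_X 1 j).
Proof. by rewrite /tow_X /=; case: ifP => h hj; [apply: weight_x | apply: ZT]; lia. Qed.

Lemma weight_X2 j : (c <= j <= (2 * N).+1 - c)%N -> qc q b Z (tow_X 2 j).
Proof. by rewrite /tow_X /=; case: ifP => h hj; [apply: weight_y | apply: weight_w]; lia. Qed.
End Weights.

(* Z then q-commutes with weight a with the first row and with weight b with the
   second row, at all levels from c on. *)
Definition has_weights (Z : B) c a b :=
  [/\ forall d, (c <= d <= N)%N -> qc q a Z (T d),
      forall d, (c <= d <= N)%N -> qc q a Z (S d),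
      forall d, (c <= d <= N.+1)%N -> qc q (a + b) Z (P d) &
      forall d, (c <= d <= N)%N -> qc q (a + b) Z (F d)].

(** T_c, S_c and F_c have uniform weights only on the levels strictly inside c, since their
    exponents jump at level c itself. For P_c the weights hold from c on. *)
Lemma weights_T c : (0 < c <= N)%N -> has_weights (T c) c.+1 (-1) 0.
Proof.
move=> hc; split=> d hd.
- by apply: (rel_TT rel); lia.
- by have := rel_TS rel (c := c) (d := d); rewrite ifN; [apply; lia | lia].
- apply: (@qcE _ (- (1))); first lia.
  by apply/qc_sym => //; have := rel_PT rel (c := d) (d := c); rewrite ifN; [apply; lia | lia].
- apply: (@qcE _ (- (1))); first lia.
  by apply/qc_sym => //; have := rel_FT rel (c := d) (d := c); rewrite ifN; [apply; lia | lia].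
Qed.

Lemma weights_S c : (0 < c <= N)%N -> has_weights (S c) c.+1 1 0.
Proof.
move=> hc; split=> d hd.
- apply: (@qcE _ (- (-1))); first lia.
  by apply/qc_sym => //; have := rel_TS rel (c := d) (d := c); rewrite ifN; [apply; lia | lia].
- by apply: (rel_SS rel); lia.
- apply: (@qcE _ (- (-1))); first lia.
  by apply/qc_sym => //; apply: (rel_PS rel); lia.
- apply: (@qcE _ (- (-1))); first lia.
  by apply/qc_sym => //; have := rel_FS rel (c := d) (d := c); rewrite ifN; [apply; lia | lia].
Qed.

Lemma weights_P c : (0 < c <= N.+1)%N -> has_weights (P c) c (-1) 1.
Proof.
move=> hc; split=> d hd.
- by have := rel_PT rel (c := c) (d := d); rewrite ifT; [apply; lia | lia].
- by apply: (rel_PS rel); lia.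
- by apply: (rel_PP rel); lia.
- by apply: (rel_PF rel); lia.
Qed.

Lemma weights_F c : (0 < c <= N)%N -> has_weights (F c) c.+1 1 (-1).
Proof.
move=> hc; split=> d hd.
- by have := rel_FT rel (c := c) (d := d); rewrite ifN; [apply; lia | lia].
- by have := rel_FS rel (c := c) (d := d); rewrite ifT; [apply; lia | lia].
- apply: (@qcE _ (- 0)); first lia.
  by apply/qc_sym => //; apply: (rel_PF rel); lia.
- by apply: (rel_FF rel); lia.
Qed.

Lemma weightsW Z c d a b : (c <= d)%N -> has_weights Z c a b -> has_weights Z d a b.
Proof.
by move=> cd [h1 h2 h3 h4]; split=> e he; [apply: h1 | apply: h2 | apply: h3 | apply: h4]; lia.
Qed.

(** Level c is included although F_c has no uniform weight there: against T_c the exponents of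
    P_{c+1} and F_c are 1 and -1 instead of -1 and 1, so their sum is unchanged. *)
Lemma weights_H c : (1 < c <= N.+1)%N -> has_weights (tow_H c) c 2 (-2).
Proof.
move=> hc.
have sym a (X Z : B) : qc q a Z X -> qc q (- a) X Z by exact: qc_sym.
have symN a (X Z : B) : qc q (- a) Z X -> qc q a X Z by move/sym; rewrite opprK.
case: (eqVneq c N.+1) => [e|ne].
  rewrite /tow_H e eqxx; split=> d hd; try lia.
  by apply: symN; rewrite oppr0; exact: qc_one.
have qcH a1 a2 a3 a4 X : a1 + a1 = a2 + a3 + a4 ->
    qc q a1 (P c) X -> qc q a2 (P c.+1) X -> qc q a3 (F c) X -> qc q (- a4) (tow_H c) X.
  move=> ea /sym h1 /sym h2 /sym h3; apply: sym.
  rewrite /tow_H (negPf ne).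
  have hPi : qc q (- - a1) X (Pi c) by apply: (qcV q0 (P_Pi _) (Pi_P _) h1); lia.
  apply: (@qcE _ (- - a1 + (- - a1 + (- a2 + - a3)))); first lia.
  by apply: (qcM q0 hPi); apply: (qcM q0 hPi); apply: (qcM q0 h2 h3).
have rc : rng c by lia.
have rc1 : rng c.+1 by lia.
split=> d hd; have rd : rng d by lia.
- have := (qcH _ _ _ (-2) _ _ (rel_PT rel rc rd) (rel_PT rel rc1 rd) (rel_FT rel rc rd)).
  have -> : (c <= d)%N by lia.
  apply.
  by case: ltnP => h1; case: eqP => h2; lia.
- have := (qcH _ _ _ (-2) _ _ (rel_PS rel rc rd) (rel_PS rel rc1 rd) (rel_FS rel rc rd)).
  by apply; rewrite ifT; [lia | lia].
- exact: (qcH _ _ _ 0 _ _ (rel_PP rel rc rd) (rel_PP rel rc1 rd) (sym _ _ _ (rel_PF rel rd rc))).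
- exact: (qcH _ _ _ 0 _ _ (rel_PF rel rc rd) (rel_PF rel rc1 rd) (rel_FF rel rc rd)).
Qed.

Lemma T_y c : (0 < c <= N)%N -> T c * tow_y c = P c.+1 - q *: P c.
Proof. by move=> hc; rewrite /tow_y mulrA T_Ti ?mul1r //; lia. Qed.

Lemma tow_P c : (0 < c <= N)%N -> P c.+1 = T c * tow_y c + q *: P c.
Proof. by move=> hc; rewrite T_y // subrK. Qed.

Lemma tow_F c : (0 < c <= N)%N -> F c = S c * tow_r c + q *: (P c * tow_H c.+1).
Proof. by move=> hc; rewrite /tow_r mulrA S_Si ?mul1r ?subrK //; lia. Qed.

Section HasWeights.
Variables (Z : B) (c : nat) (a b : int).
Hypotheses (c0 : (0 < c)%N) (hZ : has_weights Z c a b).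

Lemma hw_H d : (c <= d <= N.+1)%N -> (1 < d)%N -> qc q 0 Z (tow_H d).
Proof. by case: hZ => *; apply: (@weight_H Z c a b). Qed.
Lemma hw_n d : (c <= d)%N -> (1 < d)%N -> qc q (a - b) Z (tow_n d).
Proof. by case: hZ => *; apply: (@weight_n Z c a b). Qed.
Lemma hw_m d : (c <= d)%N -> (1 < d)%N -> qc q (b - a) Z (tow_m d).
Proof. by case: hZ => *; apply: (@weight_m Z c a b). Qed.
Lemma hw_X1 j : (c <= j <= (2 * N).+1 - c)%N -> qc q a Z (tow_X 1 j).
Proof. by case: hZ => *; apply: (@weight_X1 Z c a b). Qed.
Lemma hw_X2 j : (c <= j <= (2 * N).+1 - c)%N -> qc q b Z (tow_X 2 j).
Proof. by case: hZ => *; apply: (@weight_X2 Z c a b). Qed.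
End HasWeights.

Definition tow_mn c := tow_m c * tow_n c =
  q ^+ 2 *: (tow_n c * tow_m c) + (q * (q ^+ 2 - 1)) *: (tow_H c - 1).

Lemma qcVl a c (X : B) : (1 < c <= N.+1)%N -> qc q a X (P c) -> qc q (- a) X (Pi c).
Proof. by move=> hc; apply: qcV => //; [exact: P_Pi | exact: Pi_P]. Qed.
Lemma qcTi a c (X : B) : rng c -> qc q a X (T c) -> qc q (- a) X (Ti c).
Proof. by move=> hc; apply: qcV => //; [exact: T_Ti | exact: Ti_T]. Qed.
Lemma qcSi a c (X : B) : rng c -> qc q a X (S c) -> qc q (- a) X (Si c).
Proof. by move=> hc; apply: qcV => //; [exact: S_Si | exact: Si_S]. Qed.

Lemma qc_tow_y a b c (X : B) : rng c -> qc q a X (T c) -> qc q b X (P c.+1) ->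
  qc q b X (P c) -> qc q (b - a) X (tow_y c).
Proof.
move=> hc /(qcTi hc) h1 h2 h3; rewrite addrC; apply: (qcM q0 h1).
by apply: qcB => //; apply: qcZ.
Qed.

Lemma qc_tow_r a b e f c (X : B) : rng c -> qc q a X (S c) -> qc q b X (F c) ->
  qc q e X (P c) -> qc q f X (tow_H c.+1) -> b = e + f -> qc q (b - a) X (tow_r c).
Proof.
move=> hc /(qcSi hc) h1 h2 h3 h4 ebf; rewrite addrC; apply: (qcM q0 h1).
by apply: qcB => //; apply: qcZ; rewrite ebf; apply: qcM.
Qed.

(** All relations but three are weight counts. The oscillator relation is the assumption, and the
    other two come from differences of two monomials, treated at the end. *)
Lemma tow_step c : (0 < c <= N)%N -> tow_mn c.+1 ->
  step_rel q (P c) (tow_H c.+1) (S c) (tow_r c) (T c) (tow_y c) (tow_n c.+1) (tow_m c.+1).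
Proof.
move=> hc mn.
have sym a (X Z : B) : qc q a Z X -> qc q (- a) X Z by exact: qc_sym.
have [rc rc1] : rng c /\ rng c.+1 by lia.
have wT := weights_T hc; have wS := weights_S hc; have wF := weights_F hc.
have wP := weights_P rc; have wP1 := weights_P rc1.
have wH : has_weights (tow_H c.+1) c.+1 2 (-2) by apply: weights_H; lia.
have hcc : (c.+1 <= c.+1 <= N.+1)%N by lia.
have hcc' : (c <= c <= N)%N by lia.
have c1 : (1 < c.+1)%N by lia.
have c0 : (0 < c.+1)%N by [].
have nT := sym _ _ _ (hw_n c0 wT (leqnn _) c1).
have nS := sym _ _ _ (hw_n c0 wS (leqnn _) c1).
have nF := sym _ _ _ (hw_n c0 wF (leqnn _) c1).
have nP := sym _ _ _ (hw_n c0 (weightsW (leqnSn c) wP) (leqnn _) c1).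
have nP1 := sym _ _ _ (hw_n c0 wP1 (leqnn _) c1).
have nH := sym _ _ _ (hw_n c0 wH (leqnn _) c1).
have mT := sym _ _ _ (hw_m c0 wT (leqnn _) c1).
have mS := sym _ _ _ (hw_m c0 wS (leqnn _) c1).
have mF := sym _ _ _ (hw_m c0 wF (leqnn _) c1).
have mP := sym _ _ _ (hw_m c0 (weightsW (leqnSn c) wP) (leqnn _) c1).
have mP1 := sym _ _ _ (hw_m c0 wP1 (leqnn _) c1).
have mH := sym _ _ _ (hw_m c0 wH (leqnn _) c1).
have HT := sym _ _ _ (hw_H c0 wT hcc c1).
have HS := sym _ _ _ (hw_H c0 wS hcc c1).
have HF := sym _ _ _ (hw_H c0 wF hcc c1).
have HP1 := sym _ _ _ (hw_H c0 wP1 hcc c1).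
have HP := sym _ _ _ (hw_H c0 (weightsW (leqnSn c) wP) hcc c1).
have PT : qc q (-1) (P c) (T c) by have := rel_PT rel rc rc; rewrite leqnn.
have P1T : qc q 1 (P c.+1) (T c) by have := rel_PT rel rc1 rc; rewrite ltnn.
have PS := rel_PS rel rc rc; have P1S := rel_PS rel rc1 rc.
have TS : qc q 0 (T c) (S c) by have := rel_TS rel rc rc; rewrite eqxx.
have FT : qc q (-1) (F c) (T c) by have := rel_FT rel rc rc; rewrite eqxx.
have FS : qc q 1 (F c) (S c) by have := rel_FS rel rc rc; rewrite leqnn.
have Py : qc q 1 (P c) (tow_y c).
  exact: (qc_tow_y rc PT (rel_PP rel rc rc1) (rel_PP rel rc rc)).
have Hy : qc q 0 (tow_H c.+1) (tow_y c) by exact: (qc_tow_y rc HT HP1 HP).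
have Sy : qc q 1 (S c) (tow_y c).
  exact: (qc_tow_y rc (sym _ _ _ TS) (sym _ _ _ P1S) (sym _ _ _ PS)).
have Fy : qc q 1 (F c) (tow_y c).
  exact: (qc_tow_y rc FT (sym _ _ _ (rel_PF rel rc1 rc)) (sym _ _ _ (rel_PF rel rc rc))).
have Pr : qc q 1 (P c) (tow_r c).
  exact: (qc_tow_r rc PS (rel_PF rel rc rc) (rel_PP rel rc rc) (sym _ _ _ HP)).
have Hr : qc q 0 (tow_H c.+1) (tow_r c).
  exact: (qc_tow_r rc HS HF HP (qc_refl _ _)).
have Tr : qc q 1 (T c) (tow_r c).
  exact: (qc_tow_r rc TS (sym _ _ _ FT) (sym _ _ _ PT) (sym _ _ _ HT)).
have yr : qc q 0 (tow_y c) (tow_r c).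
  exact: (qc_tow_r rc (sym _ _ _ Sy) (sym _ _ _ Fy) (sym _ _ _ Py) (sym _ _ _ Hy)).
split=> //.
- exact: (sym _ _ _ PS).
- exact: (sym _ _ _ HS).
- exact: (sym _ _ _ Pr).
- exact: (sym _ _ _ Hr).
- exact: (sym _ _ _ PT).
- exact: (sym _ _ _ HT).
- exact: (sym _ _ _ Py).
- exact: (sym _ _ _ Hy).
- exact: (sym _ _ _ Sy).
- exact: (qc_tow_r rc nS nF nP nH).
- exact: (qc_tow_y rc nT nP1 nP).
- exact: (qc_tow_r rc mS mF mP mH).
- exact: (qc_tow_y rc mT mP1 mP).
(* Moving S_c across F_c - q P_c H_{c+1} scales the two terms by different powers of q, which leaves
   a multiple of P_c H_{c+1}. The next case does the same with T_c and P_{c+1} - q P_c. *)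
- have Sr : S c * tow_r c = F c - q *: (P c * tow_H c.+1) by rewrite tow_F ?addrK.
  rewrite Sr /tow_r -mulrA mulrBl.
  have -> : F c * S c = q *: (S c * F c) by exact: FS.
  have -> : q *: (P c * tow_H c.+1) * S c = S c * (P c * tow_H c.+1).
    have e : S c * P c = q *: (P c * S c) by exact: (sym _ _ _ PS).
    have e2 : tow_H c.+1 * S c = S c * tow_H c.+1 by exact: (qc0 HS).
    by rewrite mulrA e -!scalerAl -!mulrA e2.
  rewrite scalerAr -mulrBr mulrA Si_S // mul1r scalerBr scalerBl scale1r scalerA -expr2.
  by rewrite addrA subrK.
- rewrite T_y // /tow_y -mulrA mulrBl.
  have -> : P c.+1 * T c = q *: (T c * P c.+1) by exact: P1T.
  have -> : q *: P c * T c = T c * P c.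
    have e : T c * P c = q *: (P c * T c) by exact: (sym _ _ _ PT).
    by rewrite e -scalerAl.
  rewrite scalerAr -mulrBr mulrA Ti_T // mul1r scalerBr scalerBl scale1r scalerA -expr2.
  by rewrite addrA subrK.
Qed.

Lemma tow_n_rec c : (c <= N)%N -> tow_n c = Pi c * (S c * T c) + tow_n c.+1.
Proof. by move=> hc; rewrite /tow_n big_ltn. Qed.
Lemma tow_m_rec c : (c <= N)%N -> tow_m c = Pi c * (tow_y c * tow_r c) + tow_m c.+1.
Proof. by move=> hc; rewrite /tow_m big_ltn. Qed.
Lemma tow_n_last : tow_n N.+1 = 0. Proof. by rewrite /tow_n big_geq. Qed.
Lemma tow_m_last : tow_m N.+1 = 0. Proof. by rewrite /tow_m big_geq. Qed.
Lemma tow_H_last : tow_H N.+1 = 1. Proof. by rewrite /tow_H eqxx. Qed.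
Lemma tow_H_rec c : (0 < c <= N)%N -> tow_H c =
  Pi c * (Pi c * ((T c * tow_y c + q *: P c) * (S c * tow_r c + q *: (P c * tow_H c.+1)))).
Proof. by move=> hc; rewrite -tow_P // -tow_F // {1}/tow_H ifN //; lia. Qed.

(** The descent ends at 2 because n_1, m_1 and H_1 would involve an inverse of P_1 = 0. *)
Lemma down_ind (p : nat -> Prop) : p N.+1 ->
  (forall c, (1 < c <= N)%N -> p c.+1 -> p c) -> forall c, (1 < c <= N.+1)%N -> p c.
Proof.
move=> p0 ps c hc; rewrite (_ : c = N.+1 - (N.+1 - c))%N; last by lia.
have : (N.+1 - c < N)%N by lia.
elim: (N.+1 - c)%N => [|i IH] hi; first by rewrite subn0.
by apply: ps; [lia | rewrite -subSn; [apply: IH | ]; lia].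
Qed.

Lemma tow_mnP c : (1 < c <= N.+1)%N -> tow_mn c.
Proof.
move: c; apply: down_ind => [|c hc mn].
  by rewrite /tow_mn tow_n_last tow_m_last tow_H_last mulr0 subrr !scaler0 addr0.
have hc' : (0 < c <= N)%N by lia.
have hc1 : (1 < c <= N.+1)%N by lia.
have := step_mn q0 (tow_step hc' mn) (Pi_P hc1) (P_Pi hc1).
have cN : (c <= N)%N by lia.
by rewrite -(tow_n_rec cN) -(tow_m_rec cN) -(tow_H_rec hc').
Qed.

Lemma tow_stepP c : (0 < c <= N)%N ->
  step_rel q (P c) (tow_H c.+1) (S c) (tow_r c) (T c) (tow_y c) (tow_n c.+1) (tow_m c.+1).
Proof. by move=> hc; apply: tow_step => //; apply: tow_mnP; lia. Qed.

Local Notation inner c j := ((c < j)%N && (j < (2 * N).+1 - c)%N).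

Section Inner.
Variables c j : nat.
Hypotheses (hc : (0 < c <= N)%N) (hj : inner c j).

Let c0 : (0 < c.+1)%N. Proof. by []. Qed.
Let rc : rng c. Proof. by lia. Qed.
Let rc1 : rng c.+1. Proof. by lia. Qed.
Let jr : (c < j <= (2 * N).+1 - c.+1)%N. Proof. by lia. Qed.
Let wP := weightsW (leqnSn c) (weights_P rc).
Let wH : has_weights (tow_H c.+1) c.+1 2 (-2). Proof. by apply: weights_H; lia. Qed.
Let sym a (X Z : B) : qc q a Z X -> qc q (- a) X Z. Proof. exact: qc_sym. Qed.

Lemma inner_T1 : qc q 1 (tow_X 1 j) (T c). Proof. exact: (sym (hw_X1 c0 (weights_T hc) jr)). Qed.
Lemma inner_T2 : qc q 0 (tow_X 2 j) (T c). Proof. exact: (sym (hw_X2 c0 (weights_T hc) jr)). Qed.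
Lemma inner_S1 : qc q (-1) (tow_X 1 j) (S c). Proof. exact: (sym (hw_X1 c0 (weights_S hc) jr)). Qed.
Lemma inner_S2 : qc q 0 (tow_X 2 j) (S c). Proof. exact: (sym (hw_X2 c0 (weights_S hc) jr)). Qed.
Lemma inner_P1 : qc q 1 (tow_X 1 j) (P c). Proof. exact: (sym (hw_X1 c0 wP jr)). Qed.
Lemma inner_P2 : qc q (-1) (tow_X 2 j) (P c). Proof. exact: (sym (hw_X2 c0 wP jr)). Qed.

Lemma inner_y1 : qc q 0 (tow_X 1 j) (tow_y c).
Proof.
exact: (qc_tow_y rc inner_T1 (sym (hw_X1 c0 (weights_P rc1) jr)) inner_P1).
Qed.
Lemma inner_y2 : qc q (-1) (tow_X 2 j) (tow_y c).
Proof.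
exact: (qc_tow_y rc inner_T2 (sym (hw_X2 c0 (weights_P rc1) jr)) inner_P2).
Qed.
Lemma inner_r1 : qc q 0 (tow_X 1 j) (tow_r c).
Proof.
exact: (qc_tow_r rc inner_S1 (sym (hw_X1 c0 (weights_F hc) jr)) inner_P1 (sym (hw_X1 c0 wH jr))).
Qed.
Lemma inner_r2 : qc q 1 (tow_X 2 j) (tow_r c).
Proof.
exact: (qc_tow_r rc inner_S2 (sym (hw_X2 c0 (weights_F hc) jr)) inner_P2 (sym (hw_X2 c0 wH jr))).
Qed.
End Inner.

Definition tow_level c := forall j, (c <= j <= (2 * N).+1 - c)%N ->
  [/\ tow_n c * tow_X 1 j = q *: (tow_X 1 j * tow_n c),
      tow_m c * tow_X 2 j = q^-1 *: (tow_X 2 j * tow_m c),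
      tow_X 2 j * tow_n c = q *: (tow_n c * tow_X 2 j) + (q * (q ^+ 2 - 1)) *: tow_X 1 j &
      tow_m c * tow_X 1 j = q *: (tow_X 1 j * tow_m c) + qh *: tow_X 2 j].

Lemma tow_X_left r c : (0 < c <= N)%N -> tow_X r c = if r == 1%N then tow_x c else tow_y c.
Proof. by move=> hc; rewrite /tow_X (_ : c <= N)%N //; lia. Qed.
Lemma tow_X_right r c : (0 < c <= N)%N ->
  tow_X r ((2 * N).+1 - c) = if r == 1%N then T c else tow_w c.
Proof.
move=> hc; rewrite /tow_X (_ : ((2 * N).+1 - c <= N)%N = false); last by lia.
by rewrite subKn //; lia.
Qed.

(** At the outer pair c, c' these are the step identities. At an inner index the term added to
    n_{c+1} or m_{c+1} only q-commutes, with the power already present, so the correction term is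
    inherited. At level N + 1 no index remains. *)
Lemma tow_levelP c : (1 < c <= N.+1)%N -> tow_level c.
Proof.
move: c; apply: down_ind => [j|c hc IH j hj]; first by lia.
have hc' : (0 < c <= N)%N by lia.
have hc1 : (1 < c <= N.+1)%N by lia.
have st := tow_stepP hc'.
have [PiP PPi] := (Pi_P hc1, P_Pi hc1).
have cN : (c <= N)%N by lia.
have [->|jc] := eqVneq j c.
  rewrite !tow_X_left //= tow_n_rec // tow_m_rec //.
  by split; [apply: (step_nx q0 st) | apply: (step_my q0 st)
    | apply: (step_yn q0 st) | apply: (step_mx q0 st)].
have [->|jc'] := eqVneq j ((2 * N).+1 - c)%N.
  rewrite !tow_X_right //= tow_n_rec // tow_m_rec //.
  by split; [apply: (step_nt q0 st) | apply: (step_mw q0 st)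
    | apply: (step_wn q0 st) | apply: (step_mt q0 st)].
have ji : inner c j by lia.
have [|h1 h2 h3 h4] := IH j; first by lia.
have iP1 := qcVl hc1 (inner_P1 hc' ji); have iP2 := qcVl hc1 (inner_P2 hc' ji).
have a1 := qc_sym q0 (qcM q0 iP1 (qcM q0 (inner_S1 hc' ji) (inner_T1 hc' ji))).
have a2 := qcM q0 iP2 (qcM q0 (inner_S2 hc' ji) (inner_T2 hc' ji)).
have b1 := qc_sym q0 (qcM q0 iP1 (qcM q0 (inner_y1 hc' ji) (inner_r1 hc' ji))).
have b2 := qc_sym q0 (qcM q0 iP2 (qcM q0 (inner_y2 hc' ji) (inner_r2 hc' ji))).
rewrite tow_n_rec // tow_m_rec //; split.
- by rewrite mulrDl mulrDr h1 scalerDr; congr (_ + _); exact: a1.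
- by rewrite mulrDl mulrDr h2 scalerDr; congr (_ + _); exact: b2.
- by rewrite mulrDl mulrDr h3 scalerDr addrA; congr (_ + _ + _); exact: a2.
- by rewrite mulrDl mulrDr h4 scalerDr addrA; congr (_ + _ + _); exact: b1.
Qed.

Section Pairs.
Variables c j : nat.
Hypotheses (hc : (0 < c <= N)%N) (hj : inner c j).
Local Notation ce := ((2 * N).+1 - c)%N.

Let lev : [/\ tow_n c.+1 * tow_X 1 j = q *: (tow_X 1 j * tow_n c.+1),
      tow_m c.+1 * tow_X 2 j = q^-1 *: (tow_X 2 j * tow_m c.+1),
      tow_X 2 j * tow_n c.+1 = q *: (tow_n c.+1 * tow_X 2 j) + (q * (q ^+ 2 - 1)) *: tow_X 1 j &
      tow_m c.+1 * tow_X 1 j = q *: (tow_X 1 j * tow_m c.+1) + qh *: tow_X 2 j].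
Proof. by apply: tow_levelP; lia. Qed.

Lemma pair_11_left : tow_X 1 j * tow_X 1 c = q^-1 *: (tow_X 1 c * tow_X 1 j).
Proof.
have [h1 _ _ _] := lev; rewrite (tow_X_left _ hc) /=.
change (qc q (-1) (tow_X 1 j) (tow_x c)).
apply: qcB; first exact: inner_S1.
apply: qcZ; apply: (@qcE _ (0 + -1)) => //; apply: (qcM q0 (inner_y1 hc hj)).
by apply: (qc_sym (a := 1) q0).
Qed.

Lemma pair_11_right : tow_X 1 ce * tow_X 1 j = q^-1 *: (tow_X 1 j * tow_X 1 ce).
Proof. by rewrite (tow_X_right _ hc) /=; exact: (qc_sym q0 (inner_T1 hc hj)). Qed.

Lemma pair_22_left : tow_X 2 j * tow_X 2 c = q^-1 *: (tow_X 2 c * tow_X 2 j).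
Proof. by rewrite (tow_X_left _ hc) /=; exact: (inner_y2 hc hj). Qed.

Lemma pair_22_right : tow_X 2 ce * tow_X 2 j = q^-1 *: (tow_X 2 j * tow_X 2 ce).
Proof.
have [_ h2 _ _] := lev; rewrite (tow_X_right _ hc) /=.
apply: (@qc_sym _ _ _ q0 1).
apply: qcB; first exact: inner_r2.
apply: (@qcE _ (0 + 1)) => //; apply: (qcM q0 (inner_T2 hc hj)).
by apply: (qc_sym (a := -1) q0).
Qed.

Lemma pair_21_left : tow_X 2 c * tow_X 1 j = tow_X 1 j * tow_X 2 c.
Proof. by rewrite (tow_X_left _ hc) /=; apply/esym/qc0/inner_y1. Qed.

Lemma pair_21_right : tow_X 2 j * tow_X 1 ce = tow_X 1 ce * tow_X 2 j.
Proof. by rewrite (tow_X_right _ hc) /=; apply/qc0/inner_T2. Qed.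

(** The extra term arises because x_c contains y_c n_{c+1} and n_{c+1} raises X_{2j} to X_{1j}. In
    the right-hand version w_c contains T_c m_{c+1} and m_{c+1} lowers X_{1j} to X_{2j}. *)
Lemma pair_12_left : tow_X 2 j * tow_X 1 c =
  tow_X 1 c * tow_X 2 j - qh *: (tow_X 1 j * tow_X 2 c).
Proof.
have [_ _ h3 _] := lev; rewrite !(tow_X_left _ hc) /=.
have eS : tow_X 2 j * S c = S c * tow_X 2 j by exact: (qc0 (inner_S2 hc hj)).
have ey : tow_X 2 j * tow_y c = q^-1 *: (tow_y c * tow_X 2 j) by exact: inner_y2.
have ey1 : tow_X 1 j * tow_y c = tow_y c * tow_X 1 j by exact: (qc0 (inner_y1 hc hj)).
rewrite /tow_x mulrBr mulrBl eS -scalerAr mulrA ey -!scalerAl -mulrA h3 ey1 mulrDr -!scalerAr.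
by rewrite mulrA; lin_split k; field.
Qed.

Lemma pair_12_right : tow_X 2 ce * tow_X 1 j =
  tow_X 1 j * tow_X 2 ce - qh *: (tow_X 1 ce * tow_X 2 j).
Proof.
have [_ _ _ h4] := lev; rewrite !(tow_X_right _ hc) /=.
have er : tow_X 1 j * tow_r c = tow_r c * tow_X 1 j by exact: (qc0 (inner_r1 hc hj)).
have eT : tow_X 1 j * T c = q *: (T c * tow_X 1 j) by exact: inner_T1.
rewrite /tow_w mulrBr mulrBl er -(mulrA (T c) (tow_m _)) h4 mulrDr.
rewrite (mulrA _ (T c)) eT -!scalerAr -!scalerAl mulrA.
by lin_split k; field.
Qed.
End Pairs.

Lemma big_scaled_rec (f : nat -> B) c : (c <= N)%N ->
  \sum_(c <= l < N.+1) q ^+ (l - c) *: f l =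
  f c + q *: \sum_(c.+1 <= l < N.+1) q ^+ (l - c.+1) *: f l.
Proof.
move=> hc; rewrite big_ltn // subnn expr0 scale1r; congr (_ + _).
rewrite scaler_sumr [LHS]big_nat [RHS]big_nat; apply: eq_bigr => l hl.
by rewrite scalerA -exprS; congr (_ ^+ _ *: _); lia.
Qed.

Lemma tow_n_sum c : (1 < c <= N.+1)%N ->
  P c * tow_n c = \sum_(c <= l < N.+1) q ^+ (l - c) *: (tow_x l * T l).
Proof.
move: c; apply: down_ind => [|c hc IH]; first by rewrite tow_n_last mulr0 big_geq.
have hc' : (0 < c <= N)%N by lia.
have hc1 : (1 < c <= N.+1)%N by lia.
rewrite big_scaled_rec; last by lia.
have cN : (c <= N)%N by lia.
rewrite -IH (tow_n_rec cN) (tow_P hc').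
exact: (step_N q0 (tow_stepP hc') (P_Pi hc1)).
Qed.

Lemma tow_m_sum c : (1 < c <= N.+1)%N ->
  P c * tow_m c = \sum_(c <= l < N.+1) q ^+ (l - c) *: (tow_y l * tow_w l).
Proof.
move: c; apply: down_ind => [|c hc IH]; first by rewrite tow_m_last mulr0 big_geq.
have hc' : (0 < c <= N)%N by lia.
have hc1 : (1 < c <= N.+1)%N by lia.
rewrite big_scaled_rec; last by lia.
have cN : (c <= N)%N by lia.
rewrite -IH (tow_m_rec cN) (tow_P hc').
exact: (step_M (tow_stepP hc') (P_Pi hc1)).
Qed.

(** The boundary term with P_{N+1} stems from H_{N+1} = 1. Expanded by [tow_P_sum], it produces the
    sum over all l from 1 to n in the last relation. *)
Lemma tow_K_sum c : (1 < c <= N.+1)%N ->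
  tow_K c = q *: (\sum_(c <= l < N.+1) q ^+ (l - c) *: (tow_x l * tow_w l))
            + q ^+ (N.+1 - c) *: P N.+1.
Proof.
move: c; apply: down_ind => [|c hc IH].
  by rewrite /tow_K tow_n_last tow_H_last mul0r scaler0 subr0 mulr1 big_geq // scaler0
     add0r subnn expr0 scale1r.
have hc' : (0 < c <= N)%N by lia.
have hc1 : (1 < c <= N.+1)%N by lia.
rewrite big_scaled_rec; last by lia.
rewrite subSn ?exprS -?scalerA -?scalerDr -?addrA -?IH; last by lia.
have cN : (c <= N)%N by lia.
rewrite /tow_K (tow_n_rec cN) (tow_m_rec cN) (tow_H_rec hc') (tow_P hc').
exact: (step_K q0 (tow_stepP hc') (Pi_P hc1) (P_Pi hc1)).
Qed.

Lemma tow_P_sum c : (0 < c <= N.+1)%N ->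
  P c = \sum_(1 <= l < c) q ^+ (c - l - 1) *: (T l * tow_y l).
Proof.
elim: c => // c IH hc; case: c IH hc => [|c] IH hc; first by rewrite big_geq.
have hc' : (0 < c.+1 <= N)%N by lia.
rewrite (tow_P hc') IH; last by lia.
rewrite [RHS]big_nat_recr // addrC; congr (_ + _); last by rewrite subSnn expr0 scale1r.
rewrite scaler_sumr [LHS]big_nat [RHS]big_nat; apply: eq_bigr => l hl.
by rewrite scalerA -exprS; congr (_ ^+ _ *: _); lia.
Qed.

(** For s < t with t different from s', one index lies strictly inside the pair of the other: if t <
    s' the outer index is s, otherwise it is t = c' with c = t'. The opposite and equal indices are
    handled within one level. *)
Lemma tow_Xrels : Xrels N q tow_X.
Proof.
split=> [r s t hr hs st ht ne|].
  have [r1|r2] : r = 1%N \/ r = 2%N by lia.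
    rewrite {}r1; have [lt|ge] := ltnP t ((2 * N).+1 - s).
      by apply: pair_11_left; lia.
    rewrite [t](_ : t = (2 * N).+1 - ((2 * N).+1 - t))%N; last by lia.
    by apply: pair_11_right; lia.
  rewrite {}r2; have [lt|ge] := ltnP t ((2 * N).+1 - s).
    by apply: pair_22_left; lia.
  rewrite [t](_ : t = (2 * N).+1 - ((2 * N).+1 - t))%N; last by lia.
  by apply: pair_22_right; lia.
split=> [r s hr hs sN|].
  have hsN : (0 < s <= N)%N by lia.
  have st := tow_stepP hsN.
  have [->|->] : r = 1%N \/ r = 2%N by lia.
    rewrite tow_X_right // !tow_X_left //=.
    rewrite (step_tx q0 st) -(tow_P hsN) tow_n_sum; last by lia.
    congr (_ + _ *: _); rewrite [LHS]big_nat [RHS]big_nat; apply: eq_bigr => l hl.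
    rewrite tow_X_right ?tow_X_left //=; try lia.
    by congr (_ ^+ _ *: _); lia.
  rewrite tow_X_right // !tow_X_left //=.
  rewrite (step_wy q0 st) -(tow_P hsN) tow_m_sum; last by lia.
  congr (_ + _ *: _); rewrite [LHS]big_nat [RHS]big_nat; apply: eq_bigr => l hl.
  rewrite tow_X_right ?tow_X_left //=; try lia.
  by congr (_ ^+ _ *: _); lia.
split=> [s hs|].
  have [sN|sN] := leqP s N.
    have hsN : (0 < s <= N)%N by lia.
    by rewrite !tow_X_left //=; exact: (step_yx q0 (tow_stepP hsN)).
  rewrite [s](_ : s = (2 * N).+1 - ((2 * N).+1 - s))%N; last by lia.
  have hsN : (0 < (2 * N).+1 - s <= N)%N by lia.
  by rewrite !tow_X_right //=; exact: (step_wt q0 (tow_stepP hsN)).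
split=> [s t hs st ht ne|].
  have [lt|ge] := ltnP t ((2 * N).+1 - s); first by apply: pair_21_left; lia.
  rewrite [t](_ : t = (2 * N).+1 - ((2 * N).+1 - t))%N; last by lia.
  by apply: pair_21_right; lia.
split=> [s t hs st ht ne|].
  have [lt|ge] := ltnP t ((2 * N).+1 - s); first by apply: pair_12_left; lia.
  rewrite [t](_ : t = (2 * N).+1 - ((2 * N).+1 - t))%N; last by lia.
  by apply: pair_12_right; lia.
split=> [s hs sN|s hs sN]; have hsN : (0 < s <= N)%N by lia.
  rewrite tow_X_right // !tow_X_left //= (rel_y_t (tow_stepP hsN)); congr (_ + _).
  rewrite {1}tow_P_sum; last by lia.
  rewrite !scaler_sumr [LHS]big_nat [RHS]big_nat; apply: eq_bigr => l hl.
  rewrite tow_X_right ?tow_X_left //=; try lia.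
  rewrite !scalerA; congr (_ *: _).
  have -> : q ^+ (s - l) = q * q ^+ (s - l - 1) by rewrite -exprS; congr (_ ^+ _); lia.
  by field.
rewrite !tow_X_right // !tow_X_left //= (step_wx q0 (tow_stepP hsN)) -(tow_P hsN).
rewrite -/(tow_K s.+1) tow_K_sum; last by lia.
rewrite tow_P_sum; last by lia.
rewrite addrAC; congr (_ - _); rewrite scalerDr addrA; congr (_ + _ + _).
  rewrite !scaler_sumr [LHS]big_nat [RHS]big_nat; apply: eq_bigr => l hl.
  rewrite tow_X_right ?tow_X_left //=; try lia.
  rewrite !scalerA; congr (_ *: _).
  have -> : q ^+ (l - s) = q * q ^+ (l - s.+1) by rewrite -exprS; congr (_ ^+ _); lia.
  by ring.
rewrite !scaler_sumr [LHS]big_nat [RHS]big_nat; apply: eq_bigr => l hl.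
rewrite tow_X_right ?tow_X_left //=; try lia.
rewrite !scalerA; congr (_ *: _).
(* The exponent l' - s combines the power q^(N-s) in front of P_{N+1} with the power q^(N-l) inside
   it; the remaining q cancels the factor q^-1. *)
rewrite (_ : ((2 * N).+1 - l - s = ((N.+1 - s.+1) + (N.+1 - l - 1)).+1)%N); last by lia.
by rewrite exprS exprD; field.
Qed.
End Tower.

(** * Operators on functions *)

Section LinearEndomorphisms.
Variables (k : fieldType) (V : lmodType k).

Definition islin : {pred V -> V} := fun f =>
  `[< forall (c : k) u v, f (c *: u + v) = c *: f u + f v >].

Lemma islinP (f : V -> V) :
  reflect (forall (c : k) u v, f (c *: u + v) = c *: f u + f v) (f \in islin).
Proof. exact: asboolP. Qed.

Lemma islin_submod : submod_closed islin.
Proof.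
split=> [|a f g /islinP hf /islinP hg]; apply/islinP => c u v /=.
  by rewrite scaler0 addr0.
by rewrite !fctE hf hg !scalerDr !scalerA [a * c]mulrC addrACA.
Qed.

HB.instance Definition _ := GRing.isSubmodClosed.Build k (V -> V) islin islin_submod.

Record lend := Lend { lend_val :> V -> V; lend_valP : lend_val \in islin }.
HB.instance Definition _ := [isSub for lend_val].
HB.instance Definition _ := [Choice of lend by <:].
HB.instance Definition _ := [SubChoice_isSubLmodule of lend by <:].

Lemma lendP (f g : lend) : (forall v, f v = g v) -> f = g.
Proof. by move=> h; apply/val_inj/funext. Qed.

Lemma lend_lin (f : lend) (c : k) u v : f (c *: u + v) = c *: f u + f v.
Proof. by apply/islinP; exact: (lend_valP f). Qed.

Lemma lend0 (f : lend) : f 0 = 0.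
Proof.
rewrite -[X in f X](addr0 0) -[X in f (X + _)](scaler0 _ (-1)).
by rewrite lend_lin scaleN1r addNr.
Qed.
Lemma lend_linZ (f : lend) c v : f (c *: v) = c *: f v.
Proof. by rewrite -[c *: v]addr0 lend_lin lend0 addr0. Qed.
Lemma lendD (f g : lend) v : (f + g) v = f v + g v. Proof. by []. Qed.
Lemma lendZ c (f : lend) v : (c *: f) v = c *: f v. Proof. by []. Qed.

Lemma lend_id_subproof : (@id V) \in islin. Proof. exact/islinP. Qed.
Lemma lend_comp_subproof (f g : lend) : f \o g \in islin.
Proof. by apply/islinP => c u v /=; rewrite !lend_lin. Qed.

Let one := Lend lend_id_subproof.
Let mul f g := Lend (lend_comp_subproof f g).
Let mulA : associative mul. Proof. by move=> f g h; apply: lendP. Qed.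
Let mul1 : left_id one mul. Proof. by move=> f; apply: lendP. Qed.
Let mulr1 : right_id one mul. Proof. by move=> f; apply: lendP. Qed.
Let mulDl : left_distributive mul +%R.
Proof. by move=> f g h; apply: lendP. Qed.
Let mulDr : right_distributive mul +%R.
Proof.
move=> f g h; apply: lendP => v.
by have := lend_lin f 1 (g v) (h v); rewrite !scale1r.
Qed.
HB.instance Definition _ := GRing.Zmodule_isPzRing.Build lend mulA mul1 mulr1 mulDl mulDr.

Lemma lendM (f g : lend) v : (f * g) v = f (g v). Proof. by []. Qed.
Lemma lend1 v : (1 : lend) v = v. Proof. by []. Qed.
Lemma lend_scaleAl c (f g : lend) : c *: (f * g) = (c *: f) * g.
Proof. exact: lendP. Qed.
Lemma lend_scaleAr c (f g : lend) : c *: (f * g) = f * (c *: g).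
Proof. by apply: lendP => v; rewrite !(lendZ, lendM) lend_linZ. Qed.
End LinearEndomorphisms.

Section FunctionOperators.
Variables (k : fieldType) (I : nmodType).
Definition fop := lend (I -> k^o).
HB.instance Definition _ := GRing.Lmodule.on fop.
HB.instance Definition _ := GRing.PzRing.on fop.
Lemma fop_nz : (1 : fop) != 0.
Proof.
apply/eqP => /(congr1 (fun f : fop => f (fun=> 1) 0)).
by rewrite lend1 => /eqP; rewrite oner_eq0.
Qed.
HB.instance Definition _ := GRing.PzSemiRing_isNonZero.Build fop fop_nz.
HB.instance Definition _ := GRing.Lmodule_isLalgebra.Build k fop (@lend_scaleAl _ _).
HB.instance Definition _ := GRing.Lalgebra_isAlgebra.Build k fop (@lend_scaleAr _ _).
End FunctionOperators.

(** * Weight filtration, twisted monomials and leading terms *)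

Section WeightFiltration.
Variables (k : fieldType) (G : nmodType) (wt : G -> int).
Local Notation fop := (fop k G).

(** The degree filtration is read from supports of functions, so no expansion of an operator into
    monomials is needed. *)
Definition raises_le (w : int) (T : fop) :=
  forall (f : G -> k^o) m, (forall h, m < wt h -> f h = 0) ->
    forall h, m + w < wt h -> T f h = 0.

Lemma raises_le0 w : raises_le w 0. Proof. by []. Qed.
Lemma raises_leD w S T : raises_le w S -> raises_le w T -> raises_le w (S + T).
Proof. by move=> hS hT f m hf h hh; rewrite lendD fctE (hS f m) // (hT f m) // addr0. Qed.
Lemma raises_leZ w c T : raises_le w T -> raises_le w (c *: T).
Proof. by move=> hT f m hf h hh; rewrite lendZ fctE (hT f m) // scaler0. Qed.
Lemma raises_leM w w' S T : raises_le w S -> raises_le w' T -> raises_le (w + w') (S * T).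
Proof.
move=> hS hT f m hf h hh; rewrite lendM; apply: (hS _ (m + w')); last by move: hh; lia.
by move=> h'; apply: hT.
Qed.
Lemma raises_leW w w' T : w <= w' -> raises_le w T -> raises_le w' T.
Proof. by move=> ww hT f m hf h hh; apply: (hT f m) => //; move: ww hh; lia. Qed.
End WeightFiltration.

Section TwistedMonomials.
Variables (k : fieldType) (G : zmodType) (q : k) (b : G -> G -> int).
Hypothesis q0 : q != 0.
Hypothesis bDl : forall x y z, b (x + y) z = b x z + b y z.
Hypothesis bDr : forall x y z, b x (y + z) = b x y + b x z.
Local Notation fop := (fop k G).

(** This is the left regular action of the group algebra twisted by the bicharacter q^b: the point
    mass at x goes to q^b(g,x) times the point mass at g + x. *)
Definition tmon_fun (g : G) (f : G -> k^o) : G -> k^o :=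
  fun h => q ^ b g (h - g) * f (h - g).
Lemma tmon_subproof g : tmon_fun g \in @islin k (G -> k^o).
Proof.
apply/islinP => c u v; apply/funext => h.
by rewrite /tmon_fun !fctE mulrDr /GRing.scale /= mulrCA.
Qed.
Definition tmon g : fop := Lend (tmon_subproof g).

Lemma tmonE g (f : G -> k^o) h : tmon g f h = q ^ b g (h - g) * f (h - g).
Proof. by []. Qed.

Lemma tmonM g h : tmon g * tmon h = q ^ b g h *: tmon (g + h).
Proof.
apply: lendP => f; apply/funext => x.
rewrite lendM lendZ fctE !tmonE.
have -> : x - g - h = x - (g + h) by rewrite opprD addrA.
have -> : x - g = h + (x - (g + h)) by rewrite [RHS]addrC opprD addrA subrK.
by rewrite bDr bDl /GRing.scale /= !expfzDr // !mulrA [_ * _ * q ^ b h _]mulrAC.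
Qed.

Lemma b0l x : b 0 x = 0. Proof. by apply: (addIr (b 0 x)); rewrite -bDl !add0r. Qed.

Lemma tmon0 : tmon 0 = 1.
Proof.
by apply: lendP => f; apply/funext => x; rewrite lend1 tmonE b0l expr0z mul1r subr0.
Qed.

Variable wt : G -> int.
Local Notation raises_le := (raises_le wt).
Hypothesis wtD : forall x y, wt (x + y) = wt x + wt y.
Hypothesis wtN : forall x, wt (- x) = - wt x.

Lemma raises_le_tmon g : raises_le (wt g) (tmon g).
Proof.
move=> f m hf h hh; rewrite tmonE hf ?mulr0 // wtD wtN; by move: hh; lia.
Qed.

Definition has_lead (g : G) (T : fop) :=
  exists c E, [/\ c != 0, T = c *: tmon g + E & raises_le (wt g - 1) E].

Lemma has_lead_le g T : has_lead g T -> raises_le (wt g) T.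
Proof.
case=> c [E [_ -> hE]]; apply: raises_leD; first exact/raises_leZ/raises_le_tmon.
by apply: raises_leW hE; lia.
Qed.

Lemma has_leadD g T E : has_lead g T -> raises_le (wt g - 1) E -> has_lead g (T + E).
Proof.
case=> c [E' [c0 -> hE']] hE; exists c, (E' + E); split=> //; first by rewrite addrA.
exact: raises_leD.
Qed.

Lemma has_lead_tmon g : has_lead g (tmon g).
Proof. by exists 1, 0; rewrite oner_eq0 scale1r addr0; split. Qed.

Lemma has_lead1 : has_lead 0 1.
Proof. by rewrite -tmon0; exact: has_lead_tmon. Qed.

Lemma has_leadM g g' S T : has_lead g S -> has_lead g' T -> has_lead (g + g') (S * T).
Proof.
move=> [c [E [c0 -> hE]]] hT; have /has_lead_le hT' := hT.
case: hT => c' [E' [c'0 eT hE']].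
exists (c * c' * q ^ b g g'), (c *: (tmon g * E') + E * T).
split; first by rewrite !mulf_neq0 // expfz_neq0.
  by rewrite mulrDl {1}eT mulrDr -!scalerAl -scalerAr tmonM !scalerA addrA -mulrA.
rewrite wtD; apply: raises_leD; last first.
  have := raises_leM hE hT'. apply: raises_leW; lia.
apply: raises_leZ; have := raises_leM (@raises_le_tmon g) hE'. apply: raises_leW; lia.
Qed.

Lemma has_leadX g T e : has_lead g T -> has_lead (g *+ e) (T ^+ e).
Proof.
move=> h; elim: e => [|e IH]; first by rewrite mulr0n expr0; exact: has_lead1.
by rewrite mulrS exprS; exact: has_leadM.
Qed.

Lemma has_lead_prod (I : Type) (s : seq I) (L : I -> G) (X : I -> fop) :
  (forall i, has_lead (L i) (X i)) -> has_lead (\sum_(i <- s) L i) (\prod_(i <- s) X i).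
Proof.
move=> h; elim: s => [|i s IH]; first by rewrite !big_nil; exact: has_lead1.
by rewrite !big_cons; exact: has_leadM.
Qed.

(* Apply the sum to the point mass at 0 and evaluate at a leading exponent of
   maximal weight among those with non-zero coefficient. *)
Lemma has_lead_free (I : eqType) (s : seq I) (L : I -> G) (X : I -> fop) (c : I -> k) :
  uniq s -> {in s &, injective L} -> {in s, forall i, has_lead (L i) (X i)} ->
  \sum_(i <- s) c i *: X i = 0 -> {in s, forall i, c i = 0}.
Proof.
move=> us inj hX h0 i0 i0s; apply/eqP/negPn/negP => ci0.
pose s' := [seq i <- s | c i != 0].
have : exists2 i, i \in s' & forall j, j \in s' -> wt (L j) <= wt (L i).
  have : i0 \in s' by rewrite mem_filter ci0.
  elim: (s') i0 {i0s ci0} => // i r IH i0 _.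
  case: r IH => [_|j r /(_ j)]; first by exists i; rewrite ?mem_head // => j; rewrite inE => /eqP->.
  rewrite mem_head => /(_ isT) [m mr hm].
  have [le|/ltW le] := leP (wt (L m)) (wt (L i)).
    exists i; rewrite ?mem_head // => l; rewrite inE => /orP[/eqP->//|/hm]; move/le_trans; exact.
  exists m; first by rewrite inE mr orbT.
  by move=> l; rewrite inE => /orP[/eqP->//|/hm].
move=> [i]; rewrite mem_filter => /andP[ci is_ hi].
pose d : G -> k^o := fun h => (h == 0)%:R.
have hd : forall h, 0 < wt h -> d h = 0.
  move=> h; rewrite /d; case: eqP => // ->.
  have w0 : wt 0 = 0 by have := wtD 0 0; rewrite addr0; lia.
  by rewrite w0 ltxx.
have mon j : tmon (L j) d (L i) = q ^ b (L j) (L i - L j) * (L i == L j)%:R.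
  by rewrite tmonE /d subr_eq0.
(* The leading monomial of [X j] moves the mass at 0 to [L j], which differs from [L i], and its
   remainder lives in weights below that of [L j], hence below that of [L i]. *)
have zero j : j \in s -> j != i -> c j != 0 -> X j d (L i) = 0.
  move=> js ji cj; have [a [E [a0 -> hE]]] := hX _ js.
  rewrite lendD lendZ !fctE mon eq_sym (inj_in_eq inj) // (negPf ji) mulr0.
  rewrite [_ *: _]mulr0 add0r (hE d 0) // add0r.
  by have := hi j; rewrite mem_filter cj js => /(_ isT); lia.
have := congr1 (fun T : fop => T d (L i)) h0.
have sumE (r : seq I) : (\sum_(i <- r) c i *: X i) d (L i) = \sum_(j <- r) c j * X j d (L i).
  by elim: r => [|j r IH]; rewrite ?big_nil // !big_cons lendD fctE IH.
rewrite sumE (bigD1_seq i) //= big1_seq ?addr0; last first.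
  move=> j /andP[ji js]; have [->|cj] := eqVneq (c j) 0; first by rewrite mul0r.
  by rewrite zero // mulr0.
have [a [E [a0 -> hE]]] := hX _ is_.
rewrite lendD lendZ !fctE mon eqxx mulr1 (hE d 0) //; last by lia.
rewrite addr0 => /eqP; rewrite mulf_eq0 (negPf ci) /= [_ *: _]/(_ * _) mulf_eq0 (negPf a0) /=.
by rewrite (negPf (expfz_neq0 _ q0)).
Qed.
End TwistedMonomials.

(** * The quantum torus *)

Section Lattice.
Variable N : nat.

Definition lat : zmodType := {ffun 'I_4 * 'I_N.+2 -> int}.
Definition lat_e (a c : nat) : lat := [ffun i => (i == (inord a, inord c))%:R].

(* The first index is 0, 1, 2, 3 for T, S, P, F, the second one is the level. *)
Definition lat_b (a c a' d : nat) : int :=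
  match a, a' with
  | 0, 0 => if (c < d)%N then -1 else 0
  | 0, 1 => if c == d then 0 else -1
  | 1, 1 => if (c < d)%N then 1 else 0
  | 2, 0 => if (c <= d)%N then -1 else 1
  | 2, 1 => -1
  | 3, 0 => if c == d then -1 else 1
  | 3, 1 => if (c <= d)%N then 1 else -1
  | _, _ => 0
  end.

Definition lat_form (g h : lat) : int :=
  \sum_(i : 'I_4 * 'I_N.+2) \sum_(j : 'I_4 * 'I_N.+2) lat_b i.1 i.2 j.1 j.2 * g i * h j.

Lemma lat_formDl x y z : lat_form (x + y) z = lat_form x z + lat_form y z.
Proof.
rewrite -big_split; apply: eq_bigr => i _; rewrite -big_split; apply: eq_bigr => j _ /=.
by rewrite ffunE mulrDr mulrDl.
Qed.
Lemma lat_formDr x y z : lat_form x (y + z) = lat_form x y + lat_form x z.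
Proof.
rewrite -big_split; apply: eq_bigr => i _; rewrite -big_split; apply: eq_bigr => j _ /=.
by rewrite ffunE mulrDr.
Qed.

Lemma lat_sum_e (f : 'I_4 * 'I_N.+2 -> int) a c :
  \sum_i f i * lat_e a c i = f (inord a, inord c).
Proof.
rewrite (bigD1 (inord a, inord c)) //= ffunE eqxx mulr1 big1 ?addr0 // => i ne.
by rewrite ffunE (negPf ne) mulr0.
Qed.

Lemma lat_form_e a c a' d : (a < 4)%N -> (a' < 4)%N -> (c <= N.+1)%N -> (d <= N.+1)%N ->
  lat_form (lat_e a c) (lat_e a' d) = lat_b a c a' d.
Proof.
move=> ha ha' hc hd; rewrite /lat_form.
under eq_bigr => i _ do rewrite lat_sum_e.
by rewrite lat_sum_e /= !inordK.
Qed.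

(** Growth of P in c makes P_{c+1} dominate P_c, and S_c of weight -c dominates y_c n_{c+1} of
    weight at most -c-1. The slope 3 lets r_c dominate T_c m_{c+1}, by exactly 1 in the bounds
    below. The constant 4N + 1 lets F_N, of weight N + 1, dominate P_N. *)
Definition lat_wt (a c : nat) : int :=
  match a with 0 => 0 | 1 => - c%:Z | 2 => c%:Z | _ => (4 * N + 1)%N%:Z - 3 * c%:Z end.
Definition wt (g : lat) : int := \sum_(i : 'I_4 * 'I_N.+2) lat_wt i.1 i.2 * g i.

Lemma wtD x y : wt (x + y) = wt x + wt y.
Proof. by rewrite -big_split; apply: eq_bigr => i _; rewrite ffunE mulrDr. Qed.
Lemma wtN x : wt (- x) = - wt x.
Proof. by rewrite -sumrN; apply: eq_bigr => i _; rewrite ffunE mulrN. Qed.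
Lemma wt_e a c : (a < 4)%N -> (c <= N.+1)%N -> wt (lat_e a c) = lat_wt a c.
Proof. by move=> ha hc; rewrite /wt lat_sum_e /= !inordK. Qed.

Lemma lat_formN x y : lat_form x (- y) = - lat_form x y.
Proof.
by apply/eqP; rewrite -addr_eq0 -lat_formDr addNr; apply/eqP/(addIr (lat_form x 0));
  rewrite -lat_formDr !add0r.
Qed.
Lemma lat_formNl x y : lat_form (- x) y = - lat_form x y.
Proof.
by apply/eqP; rewrite -addr_eq0 -lat_formDl addNr; apply/eqP/(addIr (lat_form 0 y));
  rewrite -lat_formDl !add0r.
Qed.

Lemma lat_b_diag a c : lat_b a c a c = 0.
Proof. by case: a => [|[|[|[|a]]]] //=; rewrite ltnn. Qed.

Lemma wt_T c : (c <= N.+1)%N -> wt (lat_e 0 c) = 0. Proof. by move=> h; rewrite wt_e. Qed.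
Lemma wt_S c : (c <= N.+1)%N -> wt (lat_e 1 c) = - c%:Z. Proof. by move=> h; rewrite wt_e. Qed.
Lemma wt_P c : (c <= N.+1)%N -> wt (lat_e 2 c) = c%:Z. Proof. by move=> h; rewrite wt_e. Qed.
Lemma wt_F c : (c <= N.+1)%N -> wt (lat_e 3 c) = (4 * N + 1)%N%:Z - 3 * c%:Z.
Proof. by move=> h; rewrite wt_e. Qed.

Definition gen_lead t : lat :=
  if (t < N)%N then lat_e 1 t.+1
  else if (t < 2 * N)%N then lat_e 0 (2 * N - t)
  else if (t < 3 * N)%N then - lat_e 0 (t - 2 * N).+1 + lat_e 2 (t - 2 * N).+2
  else - lat_e 1 (4 * N - t) + lat_e 3 (4 * N - t).

Lemma lat_eE a c b d : (a < 4)%N -> (b < 4)%N -> (c <= N.+1)%N -> (d <= N.+1)%N ->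
  lat_e a c (inord b, inord d) = ((a == b) && (c == d))%:R.
Proof.
move=> ha hb hc hd; rewrite ffunE xpair_eqE; congr (_ && _)%:R; apply/eqP/eqP => [|->] //.
  by move/(congr1 val); rewrite /= !inordK.
by move/(congr1 val); rewrite /= !inordK.
Qed.

Definition comb (a : nat -> nat) : lat := \sum_(t < 4 * N) gen_lead t *+ a t.

Lemma lat_addE (x y : lat) i : (x + y) i = x i + y i. Proof. by rewrite ffunE. Qed.
Lemma lat_oppE (x : lat) i : (- x) i = - x i. Proof. by rewrite ffunE. Qed.

Lemma comb_coord a b d (f : nat -> int) :
  (forall t, (t < 4 * N)%N -> gen_lead t (inord b, inord d) = f t) ->
  comb a (inord b, inord d) = \sum_(t < 4 * N) f t * (a t)%:Z.
Proof.
move=> hf; rewrite /comb sum_ffunE; apply: eq_bigr => t _.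
rewrite -hf //; elim: (a t) => [|m IH]; first by rewrite mulr0n mulr0 ffunE.
by rewrite mulrSr ffunE IH -(addn1 m) PoszD mulrDr mulr1.
Qed.

Lemma sum_delta M (a : nat -> nat) t0 : (t0 < M)%N ->
  \sum_(t < M) (t == t0 :> nat)%:R * (a t)%:Z = a t0.
Proof.
move=> h; rewrite (bigD1 (Ordinal h)) //= eqxx mul1r big1 ?addr0 // => t ne.
by rewrite (_ : (t == t0 :> nat) = false) ?mul0r //; apply/negbTE.
Qed.

(** The system is triangular. Each P and F coordinate sees one generator of the second row; each S
    and T coordinate then sees one generator of the first row minus one of the second, whose
    exponent is already known. *)
Lemma gen_lead_free (a a' : nat -> nat) :
  comb a = comb a' -> forall t, (t < 4 * N)%N -> a t = a' t.
Proof.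
move=> eL.
have eq1 b d t0 : (t0 < 4 * N)%N ->
    (forall t, (t < 4 * N)%N -> gen_lead t (inord b, inord d) = (t == t0)%:R) ->
    a t0 = a' t0.
  move=> h hf; have := congr1 (fun g : lat => g (inord b, inord d)) eL.
  by rewrite !(comb_coord _ hf) !sum_delta // => -[].
have eq2 b d t0 t1 : (t0 < 4 * N)%N -> (t1 < 4 * N)%N -> a t1 = a' t1 ->
    (forall t, (t < 4 * N)%N ->
       gen_lead t (inord b, inord d) = (t == t0)%:R - (t == t1)%:R) ->
    a t0 = a' t0.
  move=> h h' e1 hf; have := congr1 (fun g : lat => g (inord b, inord d)) eL.
  rewrite !(comb_coord _ hf).
  do 2 (under eq_bigr do rewrite mulrBl; rewrite sumrB !sum_delta //).
  by rewrite e1 => /addIr [].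
have coordE b d t : (b < 4)%N -> (0 < d <= N.+1)%N -> (t < 4 * N)%N ->
    gen_lead t (inord b, inord d) =
    if (t < N)%N then ((1 == b)%N && (t.+1 == d)%N)%:R
    else if (t < 2 * N)%N then ((0 == b)%N && (2 * N - t == d)%N)%:R
    else if (t < 3 * N)%N then
      - ((0 == b)%N && ((t - 2 * N).+1 == d)%N)%:R + ((2 == b)%N && ((t - 2 * N).+2 == d)%N)%:R
    else - ((1 == b)%N && (4 * N - t == d)%N)%:R + ((3 == b)%N && (4 * N - t == d)%N)%:R.
  move=> hb hd ht; rewrite /gen_lead.
  case: (ltnP t N) => h1; first by rewrite lat_eE; lia.
  case: (ltnP t (2 * N)) => h2; first by rewrite lat_eE; lia.
  by case: (ltnP t (3 * N)) => h3; rewrite !(lat_addE, lat_oppE) !lat_eE; lia.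
have hi t : (2 * N <= t < 4 * N)%N -> a t = a' t.
  move=> ht; have [t3|t3] := ltnP t (3 * N).
    apply: (eq1 2 (t - 2 * N).+2); first by lia.
    move=> t' ht'; rewrite coordE //=; last by lia.
    case: (ltnP t' N) => h1; first by lia.
    case: (ltnP t' (2 * N)) => h2; first by lia.
    by case: (ltnP t' (3 * N)) => h3; rewrite ?oppr0 ?add0r; lia.
  apply: (eq1 3 (4 * N - t)%N); first by lia.
  move=> t' ht'; rewrite coordE //=; last by lia.
  case: (ltnP t' N) => h1; first by lia.
  case: (ltnP t' (2 * N)) => h2; first by lia.
  by case: (ltnP t' (3 * N)) => h3; rewrite ?oppr0 ?add0r; lia.
move=> t ht; have [t2|t2] := leqP (2 * N) t; first by apply: hi; lia.
have [tN|tN] := ltnP t N.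
  (* With c = t + 1, the S_c coordinate involves X_{1c} and, negatively, X_{2c'}, whose position is
     4N - c. *)
  apply: (eq2 1 t.+1 t (4 * N - t.+1)%N); [lia | lia | apply: hi; lia |].
  move=> t' ht'; rewrite coordE //=; last by lia.
  case: (ltnP t' N) => h1; first by lia.
  case: (ltnP t' (2 * N)) => h2; first by lia.
  by case: (ltnP t' (3 * N)) => h3; rewrite ?oppr0 ?add0r ?addr0; lia.
(* With c = 2N - t, the T_c coordinate involves X_{1c'} and, negatively, X_{2c}, whose position is
   2N + c - 1. *)
apply: (eq2 0 (2 * N - t)%N t (2 * N + (2 * N - t) - 1)%N); [lia | lia | apply: hi; lia |].
move=> t' ht'; rewrite coordE //=; last by lia.
case: (ltnP t' N) => h1; first by lia.
case: (ltnP t' (2 * N)) => h2; first by lia.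
by case: (ltnP t' (3 * N)) => h3; rewrite ?oppr0 ?add0r ?addr0; lia.
Qed.
End Lattice.

(** * The torus realisation and its leading terms *)

Section Torus.
Variables (k : fieldType) (q : k).
Hypothesis q0 : q != 0.
Variable N : nat.
Local Notation lat := (lat N).
Local Notation lat_e := (@lat_e N).
Local Notation lat_form := (@lat_form N).
Local Notation wt := (@wt N).
Local Notation gen_lead := (@gen_lead N).
Let lat_formDl := @lat_formDl N.
Let lat_formDr := @lat_formDr N.
Let wtD := @wtD N.
Let wtN := @wtN N.
Let wtE := (wtD, wtN, @wt_T N, @wt_S N, @wt_P N, @wt_F N).
Local Notation rng c := (0 < c <= N.+1)%N.

Local Notation op := (fop k lat).
Definition mon (g : lat) : op := tmon q lat_form g.

(** Only the antisymmetrisation of the form matters for commutation, so [lat_b] can be given in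
    one-sided form. *)
Lemma qc_mon g h : qc q (lat_form g h - lat_form h g) (mon g) (mon h).
Proof.
rewrite /qc /mon !(tmonM q0 lat_formDl lat_formDr) scalerA -expfzDr // subrK.
by rewrite addrC.
Qed.

Lemma monV a c : (a < 4)%N -> (c <= N.+1)%N -> mon (lat_e a c) * mon (- lat_e a c) = 1.
Proof.
move=> ha hc; rewrite /mon (tmonM q0 lat_formDl lat_formDr) subrr (tmon0 _ lat_formDl).
by rewrite lat_formN lat_form_e // lat_b_diag oppr0 expr0z scale1r.
Qed.
Lemma Vmon a c : (a < 4)%N -> (c <= N.+1)%N -> mon (- lat_e a c) * mon (lat_e a c) = 1.
Proof.
move=> ha hc; rewrite /mon (tmonM q0 lat_formDl lat_formDr) addNr (tmon0 _ lat_formDl).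
by rewrite lat_formNl lat_form_e // lat_b_diag oppr0 expr0z scale1r.
Qed.

Definition torT c := mon (lat_e 0 c).
Definition torS c := mon (lat_e 1 c).
Definition torP c : op := if c == 1%N then 0 else mon (lat_e 2 c).
Definition torF c := mon (lat_e 3 c).
Definition torTi c := mon (- lat_e 0 c).
Definition torSi c := mon (- lat_e 1 c).
Definition torPi c := mon (- lat_e 2 c).

Lemma qc_mon_e x a c a' d : (a < 4)%N -> (a' < 4)%N -> rng c -> rng d ->
  x = lat_b a c a' d - lat_b a' d a c -> qc q x (mon (lat_e a c)) (mon (lat_e a' d)).
Proof.
move=> ha ha' hc hd ->; rewrite -!(@lat_form_e N) //; try lia; exact: qc_mon.
Qed.

Lemma torus_mon : torus_rel q N torT torS torP torF.
Proof.
split=> c d hc hd.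
- by move=> cd; apply: qc_mon_e => //=; rewrite cd ltnNge (ltnW cd).
- by apply: qc_mon_e => //=; rewrite subr0.
- by move=> cd; apply: qc_mon_e => //=; rewrite cd ltnNge (ltnW cd).
- rewrite /torP; case: eqP => _; first exact: qc_zerol.
  by apply: qc_mon_e => //=; rewrite subr0.
- by rewrite /torP; case: eqP => _; [exact: qc_zerol | apply: qc_mon_e].
- rewrite /torP; case: eqP => _; first exact: qc_zerol.
  by case: eqP => _; [exact: qc_zero | apply: qc_mon_e].
- by rewrite /torP; case: eqP => _; [exact: qc_zerol | apply: qc_mon_e].
- by apply: qc_mon_e => //=; rewrite subr0.
- by apply: qc_mon_e => //=; rewrite subr0.
- exact: qc_mon_e.
Qed.

Definition torX := tow_X q N torT torS torP torF torTi torSi torPi.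

Lemma torX_rels : Xrels N q torX.
Proof.
apply: (tow_Xrels q0 torus_mon) => //; rewrite /torT /torTi /torS /torSi /torP /torPi => c hc.
- by apply: monV; lia.
- by apply: Vmon; lia.
- by apply: monV; lia.
- by apply: Vmon; lia.
- by case: eqP => [|_]; [lia | apply: monV; lia].
- by case: eqP => [|_]; [lia | apply: Vmon; lia].
Qed.

Local Notation lead := (has_lead q lat_form wt).
Local Notation raises := (raises_le wt).

Lemma raises_mon w g : wt g <= w -> raises w (mon g).
Proof. by move=> h; apply: (raises_leW h); exact: (raises_le_tmon _ q0 wtD wtN). Qed.

Lemma raises_M w w1 w2 (X Y : op) : w1 + w2 <= w -> raises w1 X -> raises w2 Y -> raises w (X * Y).
Proof. by move=> h hX hY; apply: (raises_leW h); exact: (raises_leM hX hY). Qed.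

Lemma raises_torP (w : int) c : (c <= N.+1)%N -> c%:Z <= w -> raises w (torP c).
Proof.
move=> hc h; rewrite /torP; case: eqP => _; first exact: raises_le0.
by apply: raises_mon; rewrite wt_P.
Qed.

Lemma lead_mon g : lead g (mon g). Proof. exact: has_lead_tmon. Qed.

Local Notation ty := (tow_y q torP torTi).
Local Notation tH := (tow_H N torP torF torPi).
Local Notation tr := (tow_r q N torP torF torSi torPi).
Local Notation tn := (tow_n N torT torS torPi).
Local Notation tm := (tow_m q N torP torF torTi torSi torPi).
Local Notation tx := (tow_x q N torT torS torP torTi torPi).
Local Notation tw := (tow_w q N torT torP torF torTi torSi torPi).

Lemma lead_add g (X E : op) : lead g X -> raises (wt g - 1) E -> lead g (X + E).
Proof. exact: has_leadD. Qed.

Lemma lead_le g w (X : op) : lead g X -> wt g <= w -> raises w X.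
Proof. by move=> hX h; apply: (raises_leW h); exact: (has_lead_le q0 wtD wtN hX). Qed.

Lemma raisesN w (X : op) : raises w X -> raises w (- X).
Proof. by move=> h; rewrite -scaleN1r; exact: raises_leZ. Qed.

Lemma lead_mul g h (X Y : op) : lead g X -> lead h Y -> lead (g + h) (X * Y).
Proof. exact: (has_leadM q0 lat_formDl lat_formDr wtD wtN). Qed.

Lemma torPE c : (0 < c)%N -> torP c.+1 = mon (lat_e 2 c.+1).
Proof. by case: c. Qed.

Lemma lead_y c : (0 < c <= N)%N -> lead (- lat_e 0 c + lat_e 2 c.+1) (ty c).
Proof.
move=> hc; rewrite /tow_y; apply: lead_mul; first exact: lead_mon.
rewrite torPE; last by lia.
apply: lead_add; first exact: lead_mon.
by apply/raisesN/raises_leZ/raises_torP; rewrite ?wtE; lia.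
Qed.

Lemma raises_H c : (1 < c <= N)%N -> raises ((4 * N + 2)%N%:Z - 4 * c%:Z) (tH c).
Proof.
move=> hc; rewrite /tow_H ifN; last by lia.
apply: (raises_M (w1 := - c%:Z) (w2 := (4 * N + 2)%N%:Z - 3 * c%:Z)); first lia.
  by apply: raises_mon; rewrite !wtE; lia.
apply: (raises_M (w1 := - c%:Z) (w2 := (4 * N + 2)%N%:Z - 2 * c%:Z)); first lia.
  by apply: raises_mon; rewrite !wtE; lia.
apply: (raises_M (w1 := c.+1%:Z) (w2 := (4 * N + 1)%N%:Z - 3 * c%:Z)); first lia.
  by apply: raises_torP; lia.
by apply: raises_mon; rewrite !wtE; lia.
Qed.

Lemma lead_r c : (0 < c <= N)%N -> lead (- lat_e 1 c + lat_e 3 c) (tr c).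
Proof.
move=> hc; rewrite /tow_r; apply: lead_mul; first exact: lead_mon.
apply: lead_add; first exact: lead_mon.
apply/raisesN/raises_leZ; rewrite wt_F; last by lia.
(* At c = N the factor H_{N+1} is 1, to which the bound of [raises_H] does not extend. *)
have [e|ne] := eqVneq c N.
  rewrite e tow_H_last mulr1.
  by apply: raises_torP; lia.
apply: (raises_M (w1 := c%:Z) (w2 := (4 * N + 2)%N%:Z - 4 * c.+1%:Z)); first lia.
  by apply: raises_torP; lia.
by apply: raises_H; lia.
Qed.

Lemma raises_n c : (1 < c <= N.+1)%N -> raises (- 2 * c%:Z) (tn c).
Proof.
move=> hc; rewrite /tow_n big_nat; elim/big_ind: _ => [||l hl].
- exact: raises_le0.
- by move=> X Y; exact: raises_leD.
apply: (raises_M (w1 := - l%:Z) (w2 := - l%:Z)); first lia.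
  by apply: raises_mon; rewrite !wtE; lia.
apply: (raises_M (w1 := - l%:Z) (w2 := 0)); first lia.
  by apply: raises_mon; rewrite !wtE; lia.
by apply: raises_mon; rewrite !wtE; lia.
Qed.

Lemma raises_m c : (1 < c <= N.+1)%N -> raises ((4 * N + 2)%N%:Z - 2 * c%:Z) (tm c).
Proof.
move=> hc; rewrite /tow_m big_nat; elim/big_ind: _ => [||l hl].
- exact: raises_le0.
- by move=> X Y; exact: raises_leD.
apply: (raises_M (w1 := - l%:Z) (w2 := (4 * N + 2)%N%:Z - l%:Z)); first lia.
  by apply: raises_mon; rewrite !wtE; lia.
apply: (raises_M (w1 := l.+1%:Z) (w2 := (4 * N + 1)%N%:Z - 2 * l%:Z)); first lia.
  by apply: (lead_le (lead_y _)); [lia | rewrite !wtE; lia].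
by apply: (lead_le (lead_r _)); [lia | rewrite !wtE; lia].
Qed.

Lemma lead_x c : (0 < c <= N)%N -> lead (lat_e 1 c) (tx c).
Proof.
move=> hc; apply: lead_add; first exact: lead_mon.
apply/raisesN/raises_leZ/(raises_M (w1 := c.+1%:Z) (w2 := - 2 * c.+1%:Z)).
- by rewrite wt_S; lia.
- by apply: (lead_le (lead_y _)); [lia | rewrite !wtE; lia].
- by apply: raises_n; lia.
Qed.

Lemma lead_w c : (0 < c <= N)%N -> lead (- lat_e 1 c + lat_e 3 c) (tw c).
Proof.
move=> hc; apply: lead_add; first exact: lead_r.
apply/raisesN/(raises_M (w1 := 0) (w2 := (4 * N + 2)%N%:Z - 2 * c.+1%:Z)).
- by rewrite !wtE; lia.
- by apply: raises_mon; rewrite !wtE; lia.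
- by apply: raises_m; lia.
Qed.

Lemma lead_gen t : (t < 4 * N)%N -> lead (gen_lead t) (gen N torX t).
Proof.
move=> ht; have N0 : (0 < 2 * N)%N by lia.
rewrite /gen /gen_lead /torX /tow_X.
have [t2|t2] := ltnP t (2 * N).
  rewrite divn_small // modn_small //=.
  have [tN|tN] := ltnP t N; first by apply: lead_x; lia.
  by rewrite subSS; exact: lead_mon.
have et : t = (1 * (2 * N) + (t - 2 * N))%N by lia.
have dt : (t %/ (2 * N) = 1)%N by rewrite et divnMDl // divn_small //; lia.
have mt : (t %% (2 * N) = t - 2 * N)%N by rewrite {1}et modnMDl modn_small //; lia.
rewrite dt mt /= ltnNge (leq_trans _ t2) /=; last by lia.
have -> : (t - 2 * N < N)%N = (t < 3 * N)%N by lia.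
case: ifP => h; first by apply: lead_y; lia.
have -> : ((2 * N).+1 - (t - 2 * N).+1 = 4 * N - t)%N by lia.
by apply: lead_w; lia.
Qed.

End Torus.

(** * The theorem *)

Section Generators.
Variables (k : fieldType) (A : algType k) (n : nat) (X : nat -> nat -> A).
Local Notation R := (in_subalg (gen n X)).

Lemma gen_row r j : (0 < j <= 2 * n)%N -> gen n X (r * (2 * n) + j.-1) = X r.+1 j.
Proof.
move=> hj; rewrite /gen divnMDl ?modnMDl; last by lia.
by rewrite divn_small ?modn_small ?addn0; [congr (X _ _); lia | lia | lia].
Qed.

Lemma subalg_row1 m j : (0 < j <= 2 * n)%N -> (j <= m)%N -> R m (X 1 j).
Proof. by move=> hj jm; rewrite -(gen_row 0 hj); apply: subalg_g; lia. Qed.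

Lemma subalg_row2 m j : (0 < j <= 2 * n)%N -> (2 * n + j <= m)%N -> R m (X 2 j).
Proof. by move=> hj jm; rewrite -(gen_row 1 hj); apply: subalg_g; lia. Qed.

Lemma subalg_scaled_sum m a b (c : nat -> k) (f : nat -> A) :
  (forall l, (a <= l < b)%N -> R m (f l)) -> R m (\sum_(a <= l < b) c l *: f l).
Proof.
move=> h; apply: subalg_sum => l; rewrite mem_index_iota => /h.
exact: subalgZ.
Qed.

End Generators.

(** * Reordering from the defining relations *)

Section Presentation.
Variables (k : fieldType) (A : algType k) (q : k) (n : nat) (X : nat -> nat -> A).
Hypothesis q0 : q != 0.
Hypothesis hrel : Xrels n q X.
Local Notation R := (in_subalg (gen n X)).

(** Every correction term uses only generators before [gen n X m]. In the mixed relations its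
    second-row index is below that of [gen n X m]: for instance l' < s' when l > s, and l <= n < s'.
    First-row factors then come earlier anyway. *)
Lemma gen_reorder m t : (t < m < 4 * n)%N ->
  exists c d, [/\ c != 0, R m d & gen n X m * gen n X t = c *: (gen n X t * gen n X m) + d].
Proof.
move=> /andP[tm mn]; have [h1 [h2 [h3 [h4 [h5 [h6 h7]]]]]] := hrel.
have qi0 : q^-1 != 0 by rewrite invr_eq0.
have g1 u : (u < 2 * n)%N -> gen n X u = X 1 u.+1.
  by move=> hu; rewrite -(@gen_row _ _ n X 0) ?mul0n ?add0n //; lia.
have g2 u : (2 * n <= u < 4 * n)%N -> gen n X u = X 2 (u - 2 * n).+1.
  by move=> hu; rewrite -(@gen_row _ _ n X 1) ?mul1n /=; [congr (gen n X _); lia | lia].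
have simple c x y z : c != 0 -> x = c *: (y * z) -> exists c' d,
    [/\ c' != 0, R m d & x = c' *: (y * z) + d].
  by move=> c0 ->; exists c, 0; rewrite addr0; split=> //; exact: subalg0.
have [m2|m2] := ltnP m (2 * n).
  rewrite !g1; try lia.
  case: (eqVneq m.+1 ((2 * n).+1 - t.+1)%N) => [e|ne].
    rewrite e h2; try lia.
    exists 1; eexists; split; [exact: oner_neq0 | | by rewrite scale1r; reflexivity].
    apply/subalgZ/subalg_scaled_sum => l hl.
    by apply: subalgM; apply: subalg_row1; lia.
  by apply: (simple _ _ _ _ qi0); apply: h1; lia.
have [t2|t2] := leqP (2 * n) t.
  rewrite !g2; try lia.
  case: (eqVneq (m - 2 * n).+1 ((2 * n).+1 - (t - 2 * n).+1)%N) => [e|ne].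
    rewrite e h2; try lia.
    exists 1; eexists; split; [exact: oner_neq0 | | by rewrite scale1r; reflexivity].
    apply/subalgZ/subalg_scaled_sum => l hl.
    by apply: subalgM; apply: subalg_row2; lia.
  by apply: (simple _ _ _ _ qi0); apply: h1; lia.
rewrite (g1 t) ?(g2 m); try lia.
set i := (m - 2 * n).+1; set j := t.+1.
have hi : (0 < i <= 2 * n)%N by lia.
have hj : (0 < j <= 2 * n)%N by lia.
have im : (m + 1 = 2 * n + i)%N by lia.
have in12 a b : (0 < a <= 2 * n)%N -> (0 < b < i)%N -> R m (X 1 a * X 2 b).
  by move=> ha hb; apply: subalgM; [apply: subalg_row1; lia | apply: subalg_row2; lia].
case: (ltngtP i j) => [ij|ji|<-].
- case: (eqVneq j ((2 * n).+1 - i)%N) => [e|ne].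
    rewrite e h6; try lia.
    exists q; eexists; split; [exact: q0 | | reflexivity].
    by apply/subalgZ/subalg_scaled_sum => l hl; apply: in12; lia.
  apply: (simple _ _ _ _ (oner_neq0 k)); rewrite scale1r.
  by apply: h4; lia.
- case: (eqVneq i ((2 * n).+1 - j)%N) => [e|ne].
    rewrite {1 2}e h7; try lia.
    exists q; eexists; split; [exact: q0 | | by rewrite -!addrA; reflexivity].
    apply: subalgD; last apply: subalgD.
    + by apply/subalgZ/subalg_scaled_sum => l hl; apply: in12; lia.
    + by apply/subalgZ/subalg_scaled_sum => l hl; apply: in12; lia.
    + by apply/subalgN/subalgZ/in12; lia.
  rewrite h5; try lia.
  exists 1; eexists; split; [exact: oner_neq0 | | by rewrite scale1r; reflexivity].
  by apply/subalgN/subalgZ/in12; lia.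
- by apply: (simple _ _ _ _ qi0); apply: h3; lia.
Qed.
End Presentation.

(** * Independence of the ordered monomials through the torus *)

Section Independence.
Variables (k : fieldType) (A : algType k) (q : k) (n : nat) (X : nat -> nat -> A).
Hypothesis q0 : q != 0.
Variable f : A -> fop k (lat n).
Hypothesis hf : is_alg_morph f.
Hypothesis fX : forall r j, (1 <= r <= 2)%N -> (1 <= j <= 2 * n)%N -> f (X r j) = torX q n r j.

Lemma morph_gen t : (t < 4 * n)%N -> f (gen n X t) = gen n (torX q n) t.
Proof.
move=> ht; have d2 : (t %/ (2 * n) < 2)%N by rewrite ltn_divLR; lia.
have m2 : (t %% (2 * n) < 2 * n)%N by rewrite ltn_mod; lia.
by rewrite /gen fX.
Qed.

Lemma morph_mono a : has_lead q (@lat_form n) (@wt n) (comb n a) (f (mono (gen n X) (4 * n) a)).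
Proof.
have [f1 _ fM _] := hf.
rewrite /mono big_mkord (big_morph f fM f1).
apply: (has_lead_prod q0 (@lat_formDl n) (@lat_formDr n) (@wtD n) (@wtN n)) => t.
have -> : f (gen n X t ^+ a t) = f (gen n X t) ^+ a t.
  by elim: (a t) => [|i IH]; rewrite ?expr0 // !exprS fM IH.
rewrite morph_gen //; apply: (has_leadX q0 (@lat_formDl n) (@lat_formDr n) (@wtD n) (@wtN n)).
exact: lead_gen.
Qed.

(** The morphism sends a relation among monomials to one among operators with pairwise distinct
    leading exponents, by [gen_lead_free]. *)
Lemma gen_mono_free (T : eqType) (s : seq T) (e : T -> nat -> nat) (c : T -> k) :
  uniq s -> {in s &, forall a b, (forall t, (t < 4 * n)%N -> e a t = e b t) -> a = b} ->
  \sum_(a <- s) c a *: mono (gen n X) (4 * n) (e a) = 0 -> {in s, forall a, c a = 0}.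
Proof.
move=> us inj h; have [f1 fD fM fZ] := hf.
have f0 : f 0 = 0 by rewrite -(scale0r 0) fZ scale0r.
apply: (@has_lead_free k (lat n) q (@lat_form n) q0 (@wt n) (@wtD n) T s
  (fun a => comb n (e a)) (fun a => f (mono (gen n X) (4 * n) (e a))) c us).
- by move=> a b ha hb hab; apply: (inj _ _ ha hb) => t ht; apply: (gen_lead_free hab).
- by move=> a _; exact: morph_mono.
- rewrite -[RHS]f0 -h (big_morph f fD f0); apply: eq_bigr => a _; by rewrite fZ.
Qed.
End Independence.

(** * Row-by-row flattening of exponent matrices *)

Section OrderedMonomials.
Variables (k : fieldType) (A : algType k) (n : nat) (X : nat -> nat -> A).
Local Notation E := {ffun 'I_2 * 'I_(2 * n) -> nat}.

Definition flat_exp (a : E) (t : nat) : nat :=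
  match insub (t %/ (2 * n))%N, insub (t %% (2 * n))%N with
  | Some i, Some j => a (i, j)
  | _, _ => 0%N
  end.

Lemma flat_exp_pair (a : E) (i : 'I_2) (j : 'I_(2 * n)) : flat_exp a (i * (2 * n) + j) = a (i, j).
Proof.
have n0 : (0 < 2 * n)%N by case: (2 * n)%N j => [[]|].
by rewrite /flat_exp divnMDl // modnMDl divn_small // modn_small // addn0 !valK.
Qed.

Lemma flat_exp_inj (a b : E) :
  (forall t, (t < 4 * n)%N -> flat_exp a t = flat_exp b t) -> a = b.
Proof.
move=> h; apply/ffunP => -[i j]; rewrite -!flat_exp_pair; apply: h.
have := ltn_ord i; have := ltn_ord j; nia.
Qed.

Lemma ordmono_mono (a : E) : ordmono X a = mono (gen n X) (4 * n) (flat_exp a).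
Proof.
have row (i : 'I_2) : \prod_(j < 2 * n) X i.+1 j.+1 ^+ a (i, j) =
    \prod_(0 <= t < 2 * n) gen n X (i * (2 * n) + t) ^+ flat_exp a (i * (2 * n) + t).
  rewrite big_mkord; apply: eq_bigr => j _; rewrite flat_exp_pair.
  by rewrite -(@gen_row _ _ n X i j.+1) // //; have := ltn_ord j; lia.
pose F t := gen n X t ^+ flat_exp a t.
have shift : \prod_(2 * n <= t < 4 * n) F t = \prod_(0 <= t < 2 * n) F (2 * n + t)%N.
  have -> : (4 * n = 2 * n + 2 * n)%N by lia.
  rewrite -{1}[(2 * n)%N]add0n big_addn addnK.
  by apply: eq_bigr => t _; rewrite addnC.
rewrite /ordmono !big_ord_recl big_ord0 mulr1 !row /mono.
rewrite [RHS](big_cat_nat (n := 2 * n)) //=; last by lia.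
by rewrite shift /F /bump /= mul0n mul1n.
Qed.

Definition unflat_exp (b : {ffun 'I_(4 * n) -> nat}) : E :=
  [ffun p : 'I_2 * 'I_(2 * n) => extend b (p.1 * (2 * n) + p.2)].

Lemma flat_expK (b : {ffun 'I_(4 * n) -> nat}) t : (t < 4 * n)%N ->
  flat_exp (unflat_exp b) t = extend b t.
Proof.
move=> ht; have d2 : (t %/ (2 * n) < 2)%N by rewrite ltn_divLR; lia.
have m2 : (t %% (2 * n) < 2 * n)%N by rewrite ltn_mod; lia.
rewrite [t in LHS](divn_eq t (2 * n)).
by rewrite (@flat_exp_pair _ (Ordinal d2) (Ordinal m2)) ffunE /= -divn_eq.
Qed.
End OrderedMonomials.

Theorem theorem5p3
  (k : closedFieldType) (hchar : [pchar k] =i pred0)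
  (q : k) (hq0 : q != 0) (hqtr : transcendental_over_Q q)
  (n : nat) (hn : (3 <= n)%N)
  (A : algType k) (X : nat -> nat -> A)
  (* (A, X) is the k-algebra presented by the generators X_ij and the relations *)
  (hrel : Xrels n q X)
  (hgen : forall z : A, in_subalg (gen n X) (4 * n) z)
  (huniv : forall (B : algType k) (Y : nat -> nat -> B), Xrels n q Y ->
     exists f : A -> B, is_alg_morph f /\
       (forall r j, (1 <= r <= 2)%N -> (1 <= j <= 2 * n)%N -> f (X r j) = Y r j)) :
  (* ordered monomials form a k-basis *)
  ((forall z : A, exists (s : seq {ffun 'I_2 * 'I_(2 * n) -> nat})
       (c : {ffun 'I_2 * 'I_(2 * n) -> nat} -> k),
       z = \sum_(a <- s) c a *: ordmono X a) /\
   (forall (s : seq {ffun 'I_2 * 'I_(2 * n) -> nat})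
       (c : {ffun 'I_2 * 'I_(2 * n) -> nat} -> k),
       uniq s -> \sum_(a <- s) c a *: ordmono X a = 0 ->
       forall a, a \in s -> c a = 0)) /\
  (* iterated Ore extension along X_11, ..., X_{1,2n}, X_21, ..., X_{2,2n} *)
  ((forall m, (m < 4 * n)%N ->
      is_ore_ext (in_subalg (gen n X) m) (in_subalg (gen n X) m.+1) (gen n X m)) /\
   (forall z : A, in_subalg (gen n X) (4 * n) z)).
Proof.
(* The universal property is applied to the torus operators; the resulting morphism carries
   independence back to [A]. *)
have [f [hf fX]] := huniv _ _ (torX_rels hq0 n).
have free := gen_mono_free hq0 hf fX.
have reorder := gen_reorder hq0 hrel.
split; split=> //.
- move=> z; have [s [c [us ->]]] := subalg_basis reorder (leqnn _) (hgen z).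
  (* Coefficients are indexed by flat exponents, so each matrix is flattened again before its
     coefficient is looked up. *)
  exists [seq unflat_exp b | b <- s], (fun a => c [ffun t : 'I_(4 * n) => flat_exp a t]).
  rewrite big_map; apply: eq_bigr => b _; congr (c _ *: _).
    by apply/ffunP => t; rewrite ffunE flat_expK // extend_ord.
  by rewrite ordmono_mono; apply: eq_mono => t ht; rewrite flat_expK.
- move=> s c us h0; apply: (free _ s (@flat_exp n) c us) => [a b _ _|].
    exact: flat_exp_inj.
  by rewrite -[RHS]h0; apply: eq_bigr => a _; rewrite ordmono_mono.
- by move=> m hm; exact: (ore_ext reorder free hm).
Qed.
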